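(* Let $n\ge1$, $G_{\mathbb R}=\mathrm{Sp}(2n,\mathbb R)$, and let $p$ be an integer with $0\le p\le n$. Put $r=[\frac p2]$ and $s=[\frac{n-p}2]$. Then the constant $c_p^n$ (as defined in the context) for the real form of $\mathcal O^{\mathbb C}$ corresponding to $p$, i.e. to $h=h_p=(\underbrace{1,\dots,1}_{p},\underbrace{-1,\dots,-1}_{n-p})$, is $$c_p^n=\begin{cases}0, & \text{if } n \text{ is even and } p \text{ is odd};\\ (-1)^{[\frac{p+1}2]}\binom{r+s}{r}, & \text{if } n \text{ is odd, or if } n \text{ is even and } p \text{ is even}.\end{cases}$$
   Context: Notation: $[x]$ is the integer part of $x$. $\mathfrak g=\mathfrak{sp}(2n,\mathbb C)$ with Cartan decomposition $\mathfrak g=\mathfrak k\oplus\mathfrak p$, $\mathfrak k\cong\mathfrak{gl}(n,\mathbb C)$, and $\mathfrak h\subset\mathfrak k$ is a Cartan subalgebra. $\mathfrak h$ and $\mathfrak h^*$ are identified with $\mathbb C^n$ with standard coordinates $\varepsilon_1,\dots,\varepsilon_n$ and standard bilinear form $\langle\ ,\ \rangle$. Positive roots: $\Delta^+=\{\varepsilon_i\pm\varepsilon_j\mid i<j\}\cup\{2\varepsilon_i\}$. Compact roots: $\pm(\varepsilon_i-\varepsilon_j)$, $i<j$; noncompact roots: $\pm(\varepsilon_i+\varepsilon_j)$ ($i<j$), $\pm2\varepsilon_i$. Set $\Delta_c^+=\{\varepsilon_i-\varepsilon_j\mid i<j\}$, $\rho_c$ half their sum, and $$P_K(\lambda)=\prod_{\alpha\in\Delta_c^+}\frac{\langle\lambda,\alpha\rangle}{\langle\rho_c,\alpha\rangle}.$$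 $\mathcal O^{\mathbb C}$ is the complex nilpotent orbit with partition $[2^n]$; its real forms are nilpotent $K$-orbits in $\mathfrak p$ (where $K$ is the complexification of the maximal compact subgroup), and $h$ is the semisimple element of the $\mathfrak{sl}_2$-triple of the real form. Definition of the constant attached to $h$. Let $\mathfrak l$ be the centralizer of $h$ in $\mathfrak g$, $\Delta(\mathfrak l)=\{\alpha\mid\alpha(h)=0\}$ its roots, $\Delta^+(\mathfrak l)=\Delta(\mathfrak l)\cap\Delta^+$, and $\Delta_n^+(\mathfrak l)$ the set of noncompact roots in $\Delta^+(\mathfrak l)$, with half sum $\rho_n(\mathfrak l)$. $P_{L\cap K}$ is the Weyl dimension polynomial of $\mathfrak l\cap\mathfrak k$, i.e. $P_{L\cap K}(\lambda)=\prod\langle\lambda,\alpha\rangle/\langle\rho_{\mathfrak l\cap\mathfrak k},\alpha\rangle$, the product over compact $\alpha\in\Delta^+(\mathfrak l)$ and $\rho_{\mathfrak l\cap\mathfrak k}$ being half the sum of these roots. Let $\Delta(\mathfrak p_1)$ be the set of noncompact roots $\alpha$ with $\alpha(h)=1$, let $N=\#\{\alpha\in\Delta^+\mid\alpha(h)>0\}$, and for a set $A$ of roots let $\rho(A)$ be half the sum of its elements. The constant $c=c(h)$ is defined by the polynomial identity in $\lambda\in\mathfrak h^*$ $$(-1)^N\sum_{A\subseteq\Delta_n^+(\mathfrak l),\ C\subseteq\Delta(\mathfrak p_1)}(-1)^{\#A+\#C}P_K(\lambda-\rho_n(\mathfrak l)+2\rho(A)-2\rho(C))=c\,P_{L\cap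 K}(\lambda);$$ it is known from earlier work that the left side is a constant multiple of $P_{L\cap K}$. *)

(* Defs.v *)
From HB Require Import structures.
From mathcomp Require Import all_boot all_order all_algebra.
From mathcomp Require Import finmap complex reals.

Set Implicit Arguments.
Unset Strict Implicit.
Unset Printing Implicit Defensive.

Import Order.TTheory GRing.Theory Num.Theory.

Local Open Scope fset_scope.
Local Open Scope ring_scope.

Section SymplecticRoots.
Variables (R : realType) (n : nat).

(* Both h and h^* are identified with C^n. *)
Local Notation V := 'rV[R[i]]_n.

(* Complex bilinear, not Hermitian.  It is also the evaluation pairing
   between h^* and h: alpha(h) is [pairing alpha h]. *)
Definition pairing (u v : V) : R[i] := \sum_(i < n) u ord0 i * v ord0 i.

Definition eps (i : 'I_n) : V := delta_mx ord0 i.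

Definition pos_compact_roots : {fset V} :=
  [fset eps x.1 - eps x.2 | x in [pred x : 'I_n * 'I_n | (x.1 < x.2)%N]].

(* The case x.1 = x.2 gives the long roots 2 eps_i. *)
Definition pos_noncompact_roots : {fset V} :=
  [fset eps x.1 + eps x.2 | x in [pred x : 'I_n * 'I_n | (x.1 <= x.2)%N]].

Definition pos_roots : {fset V} := pos_compact_roots `|` pos_noncompact_roots.

Definition noncompact_roots : {fset V} :=
  pos_noncompact_roots `|` [fset - a | a in pos_noncompact_roots].

Definition half_sum (S : {fset V}) : V := 2^-1 *: \sum_(a <- S) a.

Definition weyl_dim_poly (S : {fset V}) (lam : V) : R[i] :=
  \prod_(a <- S) (pairing lam a / pairing (half_sum S) a).

Definition P_K : V -> R[i] := weyl_dim_poly pos_compact_roots.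

Section Constant.
Variable h : V.

Definition levi_pos_compact_roots : {fset V} :=
  [fset a in pos_compact_roots | pairing a h == 0].

Definition levi_pos_noncompact_roots : {fset V} :=
  [fset a in pos_noncompact_roots | pairing a h == 0].

Definition P_LK : V -> R[i] := weyl_dim_poly levi_pos_compact_roots.

Definition p1_roots : {fset V} := [fset a in noncompact_roots | pairing a h == 1].

(* On C, 0 < z means that z is real and positive. *)
Definition num_pos_roots : nat := #|` [fset a in pos_roots | 0 < pairing a h] |.

Definition orbit_sum (lam : V) : R[i] :=
  (-1) ^+ num_pos_roots *
  \sum_(A <- fpowerset levi_pos_noncompact_roots)
    \sum_(C <- fpowerset p1_roots)
      (-1) ^+ (#|` A| + #|` C|) *
      P_K (lam - half_sum levi_pos_noncompact_roots
           + 2 *: half_sum A - 2 *: half_sum C).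

(* Over the infinite field C, equality of polynomials in lam is equality at
   every lam. *)
Definition is_orbit_constant (c : R[i]) : Prop :=
  forall lam : V, orbit_sum lam = c * P_LK lam.

End Constant.

Definition h_orbit (p : nat) : V := \row_(i < n) (if (i < p)%N then 1 else -1).

End SymplecticRoots.

(* Main.v *)
(** The operator [\sum_A (-1)^#A e^{2 rho(A) - rho_n}] is the product of the
    [pq] factors [e^{-a/2} - e^{a/2}], with [a = eps_i + eps_j], [i] in the first
    block and [j] in the second.  Each factor lowers the degree, so the image of the Vandermonde
    polynomial is block-antisymmetric of the smallest possible degree, hence a
    multiple of the product of the two block Vandermondes.

    The factor is found at the point [(0..p-1 | 0..q-1)].  There the
    antisymmetrised sum is the image, under the linear map [x^m |-> V(m)], of
    [V(x) V(y) prod (1 - x_i y_j)], where [x], [y] are the two blocks of variables.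
    After [y_j |-> 1/y_j] this product is a single Vandermonde
    determinant of size [n = p + q]; expanding it gives
    [\sum_w sgn(w) V(w~)], where [w~] reverses the last [q] values of [w].  The term
    vanishes unless the set of these values is stable under
    [k |-> n - 1 - k], and all other terms are equal.  So the constant counts, up
    to sign, the reversal-stable [q]-subsets of [{0..n-1}]. *)

Require Import Defs.
From mathcomp Require Import all_boot all_order all_algebra.
From mathcomp Require Import finmap complex reals.
From mathcomp Require Import fingroup perm fraction mpoly.
From mathcomp Require Import ring zify.

Set Implicit Arguments.
Unset Strict Implicit.
Unset Printing Implicit Defensive.

Import Order.TTheory GRing.Theory Num.Theory.

Local Open Scope ring_scope.

(** * Polynomial functions and their differences *)

Section PolynomialFunctions.
Variables (K : comNzRingType) (n : nat).
Local Notation V := 'rV[K]_n.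
Implicit Types (f g h : V -> K) (d : nat).

(** Degree at most [d], phrased for functions because shifts and differences act on values.
    Constants occur at every [d], so the index is only an upper bound; the pointwise equations
    replace functional extensionality. *)
Inductive poly_fun : nat -> (V -> K) -> Prop :=
| poly_fun_const d c f : (forall x, f x = c) -> poly_fun d f
| poly_fun_coord d i f g :
    poly_fun d f -> (forall x, g x = x 0 i * f x) -> poly_fun d.+1 g
| poly_fun_lin d a f g h :
    poly_fun d f -> poly_fun d g -> (forall x, h x = a * f x + g x) ->
    poly_fun d h.

Lemma eq_poly_fun d f g : poly_fun d f -> g =1 f -> poly_fun d g.
Proof.
move=> pf gf; apply: (@poly_fun_lin d 1 f (fun=> 0)) => //.
  exact: (@poly_fun_const _ 0).
by move=> x; rewrite mul1r addr0.
Qed.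

Lemma poly_fun_shift d f v : poly_fun d f -> poly_fun d (fun x => f (x + v)).
Proof.
elim=> {d f} [d c f fc|d i f g _ IH gE|d a f g h _ IHf _ IHg hE].
- by apply: (@poly_fun_const _ c) => x; apply: fc.
- apply: (@poly_fun_lin _ (v 0 i) (fun x => f (x + v))
           (fun x => x 0 i * f (x + v))).
  (* The summand carrying [v 0 i] only has bound [d]; this inner induction raises it to [d.+1]. *)
  + by elim: IH => {f g gE} [d' c f fc|d' j f g _ IH' gE|d' a f g h _ IHf _ IHg hE];
      [exact: poly_fun_const fc | exact: poly_fun_coord IH' gE |
       exact: poly_fun_lin IHf IHg hE].
  + exact: poly_fun_coord IH _.
  + by move=> x; rewrite gE mxE mulrDl addrC.
- by apply: poly_fun_lin IHf IHg _ => x; rewrite hE.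
Qed.

(** Discrete Leibniz rule: [x_i f(x) - (x_i + v_i) f(x + v)] equals
    [x_i (f(x) - f(x + v)) - v_i f(x + v)]. Bound 0 is kept apart, since no smaller bound exists and
    the difference vanishes. *)
Lemma poly_fun_diff d f v : poly_fun d f ->
  if d is d'.+1 then poly_fun d' (fun x => f x - f (x + v))
  else forall x, f x - f (x + v) = 0.
Proof.
elim=> {d f} [d c f fc|d i f g pf IH gE|d a f g h _ IHf _ IHg hE].
- case: d => [x|d]; first by rewrite !fc subrr.
  by apply: (@poly_fun_const _ 0) => x; rewrite !fc subrr.
- apply: (@poly_fun_lin _ (- v 0 i) (fun x => f (x + v))
           (fun x => x 0 i * (f x - f (x + v)))).
  + exact: poly_fun_shift.
  + case: d pf IH => [|d] pf IH.
      by apply: (@poly_fun_const _ 0) => x; rewrite IH mulr0.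
    exact: poly_fun_coord IH _.
  + by move=> x; rewrite !gE mxE; ring.
- case: d IHf IHg => [|d] IHf IHg.
    by move=> x; rewrite !hE opprD addrACA -mulrBr IHf IHg mulr0 addr0.
  by apply: (@poly_fun_lin d a _ _ _ IHf IHg) => x; rewrite !hE; ring.
Qed.

Lemma poly_fun_sum d (I : Type) (r : seq I) (F : I -> V -> K) :
  (forall i, poly_fun d (F i)) -> poly_fun d (fun x => \sum_(i <- r) F i x).
Proof.
move=> pF; elim: r => [|i r IH].
  by apply: (@poly_fun_const _ 0) => x; rewrite big_nil.
by apply: (@poly_fun_lin _ 1 _ _ _ (pF i) IH) => x; rewrite big_cons mul1r.
Qed.

Lemma poly_funZ d a f : poly_fun d f -> poly_fun d (fun x => a * f x).
Proof.
move=> pf; apply: (@poly_fun_lin _ a f (fun=> 0)) => //.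
  exact: (@poly_fun_const _ 0).
by move=> x; rewrite addr0.
Qed.

Lemma poly_fun_monomial (I : Type) (r : seq I) (j : I -> 'I_n) (k : I -> nat) :
  poly_fun (\sum_(i <- r) k i) (fun x => \prod_(i <- r) x 0 (j i) ^+ k i).
Proof.
elim: r => [|i r IH].
  by rewrite big_nil; apply: (@poly_fun_const _ 1) => x; rewrite big_nil.
suff H m : poly_fun (m + \sum_(i <- r) k i)
    (fun x => x 0 (j i) ^+ m * \prod_(i <- r) x 0 (j i) ^+ k i).
  by rewrite big_cons; apply: eq_poly_fun (H _) _ => x; rewrite big_cons.
elim: m => [|m IHm]; first by apply: eq_poly_fun IH _ => x; rewrite expr0 mul1r.
by apply: poly_fun_coord IHm _ => x; rewrite exprS mulrA.
Qed.

(** Makes single monomials available, so that antisymmetrisation can be done on each of them. *)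
Lemma poly_fun_monomials d f : poly_fun d f ->
  exists2 s : seq (K * {ffun 'I_n -> nat}),
    forall t, t \in s -> (\sum_i t.2 i <= d)%N &
    forall x, f x = \sum_(t <- s) t.1 * \prod_i x 0 i ^+ t.2 i.
Proof.
elim=> {d f} [d c f fc|d i f g _ [s sd sE] gE|d a f g h _ [s sd sE] _ [u ud uE] hE].
- exists [:: (c, [ffun=> 0%N])] => [t|x].
    by rewrite mem_seq1 => /eqP ->; rewrite /= big1// => j _; rewrite ffunE.
  by rewrite big_seq1 fc big1 ?mulr1// => i _; rewrite ffunE expr0.
- exists [seq (t.1, [ffun j => (t.2 j + (j == i))%N]) | t : K * {ffun _} <- s] => [t|x].
    move=> /mapP[w ws ->] /=; under eq_bigr do rewrite ffunE.
    rewrite big_split/= [X in (_ + X)%N](bigD1 i)//= eqxx [X in (_ + (_ + X))%N]big1.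
      by rewrite addn0 addn1 ltnS sd.
    by move=> j /negbTE->.
  rewrite gE sE big_map big_distrr/=; apply: eq_bigr => w _.
  under [X in _ = _ * X]eq_bigr do rewrite ffunE exprD.
  rewrite big_split/= [X in _ = _ * (_ * X)](bigD1 i)//= eqxx expr1.
  rewrite [X in _ * (_ * (_ * X))]big1; first by ring.
  by move=> j /negbTE->; rewrite expr0.
- exists ([seq (a * t.1, t.2) | t <- s] ++ u) => [t|x].
    by rewrite mem_cat => /orP[/mapP[w ws ->]|/ud//]; exact: (sd _ ws).
  rewrite big_cat/= big_map hE sE uE big_distrr/=; congr (_ + _).
  by apply: eq_bigr => w _; rewrite mulrA.
Qed.

End PolynomialFunctions.

(** Splitting subsets by membership of [e] peels one factor off the expanded product of difference
    operators. *)
Lemma big_powersetU1 (M : nmodType) (T : finType) (e : T) (E : {set T})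
    (G : {set T} -> M) : e \notin E ->
  \sum_(B in powerset (e |: E)) G B =
  \sum_(B in powerset E) (G B + G (e |: B)).
Proof.
move=> eE; rewrite big_split/= (bigID (fun B : {set T} => e \notin B))/=.
congr (_ + _).
  apply: eq_bigl => B; rewrite !powersetE; apply/andP/idP => [[BE eB]|BE].
    by apply/subsetP => x xB; have := subsetP BE x xB;
       rewrite !inE => /orP[/eqP xe|//]; rewrite xe (negbTE eB) in xB *.
  by split; [exact: subset_trans BE (subsetUr _ _)
            | apply: contra eE => /(subsetP BE)].
rewrite (reindex_onto (fun B => e |: B) (fun B => B :\ e)) /=.
  apply: eq_bigl => B; rewrite !powersetE negbK setU11 andbT.
  apply/andP/idP => [[BE /eqP BB]|BE].
    apply/subsetP => x xB; have := subsetP BE x.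
    rewrite !inE xB orbT => /(_ isT) /orP[/eqP xe|//].
    by rewrite -BB xe !inE eqxx in xB.
  by split; [exact: setUS | rewrite setU1K//; apply: contra eE => /(subsetP BE)].
by move=> B; rewrite negbK => /andP[_ eB]; rewrite setD1K.
Qed.

Definition cube_diff (K : comNzRingType) (n : nat) (T : finType)
    (v : T -> 'rV[K]_n) (f : 'rV[K]_n -> K) (E : {set T}) (x : 'rV[K]_n) : K :=
  \sum_(B in powerset E) (-1) ^+ #|B| * f (x + \sum_(e in B) v e).

(* A factor 1 - (shift by v e) for each e : each lowers the degree by one. *)
Lemma poly_fun_cube_diff (K : comNzRingType) (n : nat) (T : finType)
    (v : T -> 'rV[K]_n) f (E : {set T}) d :
  poly_fun (d + #|E|) f -> poly_fun d (cube_diff v f E).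
Proof.
move: {2}#|E| (erefl #|E|) => m; elim: m E d f => [|m IH] E d f Em pf.
  move: Em pf => /eqP; rewrite cards_eq0 => /eqP -> pf.
  rewrite cards0 addn0 in pf; apply: eq_poly_fun pf _ => x.
  by rewrite /cube_diff powerset0 big_set1 cards0 expr0 mul1r big_set0 addr0.
have [e eE] : exists e, e \in E by apply/set0Pn; rewrite -card_gt0 Em.
have Em' : #|E :\ e| = m by move: Em; rewrite (cardsD1 e) eE => -[].
have := IH (E :\ e) d (fun x => f x - f (x + v e)) Em'.
have -> : (d + #|E :\ e|)%N = (d + #|E|).-1 by rewrite Em Em' addnS.
have pd : poly_fun (d + #|E|).-1 (fun x => f x - f (x + v e)).
  by have := poly_fun_diff (v e) pf; rewrite Em addnS.
move=> /(_ pd) /eq_poly_fun; apply => x.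
rewrite /cube_diff -{1}(setD1K eE) big_powersetU1 ?setD11//.
apply: eq_bigr => B; rewrite powersetE => BE.
have eB : e \notin B by apply/negP => /(subsetP BE); rewrite setD11.
rewrite cardsU1 eB exprD expr1 mulN1r mulNr -mulrBr big_setU1//=.
by congr (_ * (_ - f _)); rewrite -addrA [v e + _]addrC.
Qed.

(** * Alternants and block antisymmetry *)

(** Remove the largest entry [k]. Distinctness forces [k] to be at least the number [m] of remaining
    entries, and [m] is the increment of the binomial; equality leaves no room for [k] above [m]. *)
Lemma sumn_uniq (s : seq nat) : uniq s ->
  ('C(size s, 2) <= sumn s)%N /\
  (sumn s = 'C(size s, 2) -> all (fun k => (k < size s)%N) s).
Proof.
move: {2}(size s) (erefl (size s)) => m; elim: m s => [|m IH] s sm us.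
  by rewrite (size0nil sm).
have [k ks kmax] : exists2 k, k \in s & forall j, j \in s -> (j <= k)%N.
  have [k kE] : exists k, k = foldr maxn 0%N s by eexists.
  exists k; last first.
    move=> j; rewrite {}kE; elim: s {sm us} => //= a s IHs.
    by rewrite inE leq_max => /orP[/eqP->|/IHs->]; rewrite ?leqnn ?orbT.
  rewrite kE; case: s sm {us kE} => //= a s _.
  elim: s a => [|b s IHs] a /=; first by rewrite maxn0 mem_head.
  rewrite -[maxn b _]/(foldr maxn 0%N (b :: s)) inE.
  by case: leqP => _; rewrite ?eqxx// IHs orbT.
have mk : (m <= k)%N.
  have : {subset s <= iota 0 k.+1} by move=> j js; rewrite mem_iota/= add0n ltnS kmax.
  by move=> /(uniq_leq_size us); rewrite size_iota sm ltnS.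
have srem : size (rem k s) = m by rewrite size_rem// sm.
have [le1 _] := IH _ srem (rem_uniq k us).
have -> : sumn s = (k + sumn (rem k s))%N.
  by rewrite (perm_sumn (perm_to_rem ks)).
rewrite sm binS bin1 addnC; rewrite srem in le1; split; first by lia.
move=> sE; apply/allP => j /kmax; lia.
Qed.

Section Alternants.
Variable R : comNzRingType.

(** The antisymmetrisation of the monomial [x^k], by the Leibniz formula. *)
Definition alternant (p : nat) (k : 'I_p -> nat) (x : 'rV[R]_p) : R :=
  \det (\matrix_(i < p, j < p) x 0 j ^+ k i).

Lemma alternant_noninj p (k : 'I_p -> nat) x : ~~ injectiveb k -> alternant k x = 0.
Proof.
move=> /injectivePn[i [j ij kij]]; apply: (determinant_alternate ij) => l.
by rewrite !mxE kij.
Qed.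

Lemma sumn_codom p (k : 'I_p -> nat) : sumn (codom k) = (\sum_i k i)%N.
Proof. by rewrite sumnE big_map big_enum. Qed.

Lemma alternant_eq0 p (k : 'I_p -> nat) x :
  (\sum_i k i < 'C(p, 2))%N -> alternant k x = 0.
Proof.
move=> kp; apply: alternant_noninj; apply/negP => ik.
have [+ _] := sumn_uniq ik.
by rewrite size_codom card_ord sumn_codom leqNgt kp.
Qed.

(** This is the equality case of [sumn_uniq]: distinct exponents are a permutation of [0..p-1], and
    [e] is its sign. Repeated exponents give [e = 0]. *)
Lemma alternant_min p (k : 'I_p -> nat) : \sum_i k i = 'C(p, 2) ->
  exists e, forall x, alternant k x = e * \det (Vandermonde p x).
Proof.
move=> kp; have [ik|nik] := boolP (injectiveb k); last first.
  by exists 0 => x; rewrite mul0r alternant_noninj.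
have [_] := sumn_uniq ik.
rewrite size_codom card_ord sumn_codom => /(_ kp)/allP klt.
have klt' i : (k i < p)%N by apply/klt/codom_f.
have is_ : injective (fun i => Ordinal (klt' i)).
  by move=> i j /(congr1 val)/= /(injectiveP _ ik).
exists ((-1) ^+ perm is_) => x; rewrite -det_perm -det_mulmx -row_permE.
by congr (\det _); apply/matrixP => i j; rewrite !mxE permE.
Qed.

End Alternants.

Section BlockAntisymmetry.
Variables (p q : nat).

Definition block_perm (T : Type) (s : 'S_p) (t : 'S_q) (x : 'rV[T]_(p + q)) :=
  row_mx (col_perm s (lsubmx x)) (col_perm t (rsubmx x)).

Definition block_vdm (R : comNzRingType) (x : 'rV[R]_(p + q)) : R :=
  \det (Vandermonde p (lsubmx x)) * \det (Vandermonde q (rsubmx x)).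

Lemma block_perm_l T s t (x : 'rV[T]_(p + q)) i :
  block_perm s t x 0 (lshift q i) = x 0 (lshift q (s i)).
Proof. by rewrite row_mxEl !mxE. Qed.

Lemma block_perm_r T s t (x : 'rV[T]_(p + q)) j :
  block_perm s t x 0 (rshift p j) = x 0 (rshift p (t j)).
Proof. by rewrite row_mxEr !mxE. Qed.

Lemma sum_block_perm_monomial (R : comNzRingType) (k : 'I_(p + q) -> nat)
    (x : 'rV[R]_(p + q)) :
  \sum_(s : 'S_p) \sum_(t : 'S_q)
     (-1) ^+ s * (-1) ^+ t * \prod_i block_perm s t x 0 i ^+ k i =
  alternant (k \o @lshift p q) (lsubmx x) * alternant (k \o @rshift p q) (rsubmx x).
Proof.
rewrite /alternant /determinant big_distrlr/=.
apply: eq_bigr => s _; apply: eq_bigr => t _.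
rewrite big_split_ord/= mulrACA; congr (_ * _ * (_ * _)); apply: eq_bigr => i _.
  by rewrite block_perm_l !mxE.
by rewrite block_perm_r !mxE.
Qed.

(** Permuting inside the blocks multiplies the Vandermonde matrix on the right by a block diagonal
    permutation matrix. *)
Lemma det_Vandermonde_block_perm (R : comNzRingType) s t (x : 'rV[R]_(p + q)) :
  \det (Vandermonde (p + q) (block_perm s t x)) =
  (-1) ^+ s * (-1) ^+ t * \det (Vandermonde (p + q) x).
Proof.
rewrite -{2}[x]hsubmxK /block_perm.
have VE (u : 'rV[R]_p) (v : 'rV[R]_q) : Vandermonde (p + q) (row_mx u v) =
    row_mx (Vandermonde (p + q) u) (Vandermonde (p + q) v).
  apply/matrixP => i j; rewrite mxE; case: (split_ordP j) => l ->.
    by rewrite !row_mxEl mxE.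
  by rewrite !row_mxEr mxE.
have VC m (s' : 'S_m) (u : 'rV[R]_m) : Vandermonde (p + q) (col_perm s' u) =
    Vandermonde (p + q) u *m perm_mx s'^-1.
  by rewrite -col_permE; apply/matrixP => i j; rewrite !mxE.
rewrite !VE !VC.
have -> : row_mx (Vandermonde (p + q) (lsubmx x) *m perm_mx s^-1)
                 (Vandermonde (p + q) (rsubmx x) *m perm_mx t^-1) =
    row_mx (Vandermonde (p + q) (lsubmx x)) (Vandermonde (p + q) (rsubmx x))
    *m block_mx (perm_mx s^-1) 0 0 (perm_mx t^-1).
  by rewrite mul_row_block !mulmx0 addr0 add0r.
by rewrite det_mulmx det_ublock !det_perm !odd_permV mulrC.
Qed.

(* After antisymmetrisation only monomials of degree at least that of
   [block_vdm] survive, and in that degree only multiples of [block_vdm]. *)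
Lemma block_antisym_prop (K : numFieldType) (f : 'rV[K]_(p + q) -> K) :
  poly_fun ('C(p, 2) + 'C(q, 2)) f ->
  (forall s t x, f (block_perm s t x) = (-1) ^+ s * (-1) ^+ t * f x) ->
  exists e, forall x, f x = e * block_vdm x.
Proof.
move=> /poly_fun_monomials[r rd rE] fas.
(* The order of the group of block permutations: the signed sum of the images of [f] over this group
   is [N * f], and [N] is invertible in characteristic zero. *)
pose N : K := (p`! * q`!)%:R.
have N0 : N != 0 by rewrite pnatr_eq0 muln_eq0 negb_or -!lt0n !fact_gt0.
have fE x : N * f x = \sum_(t <- r) t.1 *
    (alternant (t.2 \o @lshift p q) (lsubmx x) *
     alternant (t.2 \o @rshift p q) (rsubmx x)).
  under eq_bigr do rewrite -sum_block_perm_monomial big_distrr/=.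
  rewrite exchange_big/=.
  transitivity (\sum_(s : 'S_p) \sum_(t : 'S_q) f x).
    by rewrite !sumr_const !card_Sn -!mulrnA /N mulr_natl mulnC.
  apply: eq_bigr => s _.
  under [RHS]eq_bigr do rewrite big_distrr/=.
  rewrite exchange_big/=; apply: eq_bigr => t _.
  under eq_bigr do rewrite mulrCA.
  rewrite -big_distrr/= -rE fas mulrA -expr2 exprMn -!exprM ![(_ * 2)%N]mulnC.
  by rewrite !exprM sqrrN expr1n !expr1n !mul1r.
suff [e eE] : exists e, forall x, \sum_(t <- r) t.1 *
    (alternant (t.2 \o @lshift p q) (lsubmx x) *
     alternant (t.2 \o @rshift p q) (rsubmx x)) = e * block_vdm x.
  by exists (e / N) => x; rewrite mulrAC -eE -fE mulrAC mulfV// mul1r.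
elim: r rd {rE fE} => [|[a k] r IH] rd.
  by exists 0 => x; rewrite big_nil mul0r.
have [t tr|e eE] := IH; first by apply: rd; rewrite inE tr orbT.
have /= := rd _ (mem_head _ _); rewrite big_split_ord/= => kd.
suff [e' e'E] : exists e', forall x : 'rV[K]_(p + q),
    alternant (k \o @lshift p q) (lsubmx x) *
    alternant (k \o @rshift p q) (rsubmx x) = e' * block_vdm x.
  by exists (a * e' + e) => x; rewrite big_cons eE e'E/= mulrDl mulrA.
(* Too small a degree in the first block kills the first alternant; too large a degree there leaves
   too little for the second. Otherwise the second alternant vanishes or both degrees are
   minimal. *)
have [kp|kp|kp] := ltngtP (\sum_i k (lshift q i))%N 'C(p, 2).
- by exists 0 => x; rewrite alternant_eq0// !mul0r.
- exists 0 => x; rewrite [X in _ * X]alternant_eq0 ?mulr0 ?mul0r//=.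
  by rewrite -(ltn_add2l 'C(p, 2)); apply: leq_trans kd; rewrite ltn_add2r.
have [kq|kq] := leqP 'C(q, 2) (\sum_i k (rshift p i))%N; last first.
  by exists 0 => x; rewrite [X in _ * X]alternant_eq0 ?mulr0 ?mul0r.
have kq' : \sum_i k (rshift p i) = 'C(q, 2).
  by apply/eqP; rewrite eqn_leq kq andbT; rewrite kp leq_add2l in kd.
have [e1 E1] := alternant_min K kp; have [e2 E2] := alternant_min K kq'.
by exists (e1 * e2) => x; rewrite E1 E2 mulrACA.
Qed.

End BlockAntisymmetry.

(** * Vandermonde identities *)

Lemma sum_ltn_pairs n : (\sum_(i < n) \sum_(j < n | i < j) 1 = 'C(n, 2))%N.
Proof.
rewrite (exchange_big_dep xpredT)//= -bin2_sum big_mkord; apply: eq_bigr => j _.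
by rewrite -(big_ord_widen n (fun=> 1%N)) ?sum1_card ?card_ord// ltnW.
Qed.

Section HomogeneousVandermonde.

(** Each index lies in [n - 1] of the pairs. *)
Lemma prod_ltn_pairs (R : comNzRingType) n (b : 'I_n -> R) :
  \prod_(i < n) \prod_(j < n | (i < j)%N) (b i * b j) = \prod_(i < n) b i ^+ n.-1.
Proof.
transitivity (\prod_(i < n) \prod_(j < n | j != i) b i); last first.
  apply: eq_bigr => i _; rewrite prodr_const; congr (_ ^+ _).
  by rewrite -[in RHS](card_ord n) (cardC1 i).
under eq_bigr do rewrite big_split/=.
rewrite big_split/= [X in _ * X](exchange_big_dep xpredT)//= -big_split/=.
apply: eq_bigr => i _; rewrite [RHS](bigID (fun j : 'I_n => i < j)%N)/=.
by congr (_ * _); apply: eq_bigl => j; rewrite -val_eqE/=; lia.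
Qed.

(** Taking [b i ^+ n.-1] out of row [i] leaves the Vandermonde matrix of the ratios [a i / b i];
    these powers then clear all denominators of the product. *)
Lemma det_hom_Vandermonde_field (F : fieldType) n (a b : 'I_n -> F) :
  (forall i, b i != 0) ->
  \det (\matrix_(i, k) (a i ^+ k * b i ^+ (n.-1 - k))) =
  \prod_(i < n) \prod_(j < n | (i < j)%N) (b i * a j - a i * b j).
Proof.
move=> b0.
transitivity (\det (Vandermonde n (\row_i (a i / b i)) *m
                    diag_mx (\row_i b i ^+ n.-1))).
  rewrite -det_tr; congr (\det _); apply/matrixP => k i.
  rewrite mul_mx_diag !mxE exprMn -mulrA; congr (_ * _).
  have kn : (k <= n.-1)%N by case: n k {a b b0 i} => [[]|n [k /=]].
  by rewrite -{2}(subnKC kn) exprD exprVn mulrA mulVf ?mul1r// expf_neq0.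
rewrite det_mulmx det_Vandermonde det_diag.
under [X in _ * X]eq_bigr do rewrite mxE.
rewrite -prod_ltn_pairs -big_split/=; apply: eq_bigr => i _.
rewrite -big_split/=; apply: eq_bigr => j _; rewrite !mxE.
by field; rewrite !b0.
Qed.

(** Passes to the fraction field, because the identity is applied to polynomial variables, which are
    nonzero but not invertible. *)
Lemma det_hom_Vandermonde (R : idomainType) n (a b : 'I_n -> R) :
  (forall i, b i != 0) ->
  \det (\matrix_(i, k) (a i ^+ k * b i ^+ (n.-1 - k))) =
  \prod_(i < n) \prod_(j < n | (i < j)%N) (b i * a j - a i * b j).
Proof.
move=> b0; apply/eqP; rewrite -tofrac_eq -det_map_mx rmorph_prod/=; apply/eqP.
under [RHS]eq_bigr => i _ do [rewrite rmorph_prod/=;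
  under eq_bigr do rewrite tofracB !tofracM].
rewrite -(@det_hom_Vandermonde_field _ n (fun i => tofrac (a i)) (fun i => tofrac (b i))).
  by congr (\det _); apply/matrixP => i j; rewrite !mxE tofracM !tofracXn.
by move=> i; rewrite tofrac_eq0.
Qed.

End HomogeneousVandermonde.

(* A linear functional on polynomials is freely prescribed on monomials. *)
Lemma eq_mpoly_functional (K : comNzRingType) n (I J : finType)
    (a : I -> K) (m : I -> 'X_{1..n}) (a' : J -> K) (m' : J -> 'X_{1..n})
    (g : 'X_{1..n} -> K) :
  \sum_i a i *: 'X_[m i] = \sum_j a' j *: 'X_[m' j] :> {mpoly K[n]} ->
  \sum_i a i * g (m i) = \sum_j a' j * g (m' j).
Proof.
(* [S] lists every monomial of either side, so both sums can be read off from coefficients over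
   [S]. *)
move=> E; pose S := undup ([seq m i | i : I] ++ [seq m' j | j : J]).
have H (L : finType) (c : L -> K) (l : L -> 'X_{1..n}) :
    (forall i, l i \in S) ->
    \sum_i c i * g (l i) = \sum_(k <- S) (\sum_i c i *: 'X_[l i])@_k * g k.
  move=> lS; under [RHS]eq_bigr do rewrite raddf_sum/= big_distrl/=.
  rewrite exchange_big/=; apply: eq_bigr => i _.
  rewrite (bigD1_seq (l i))//= ?undup_uniq// big1 ?addr0.
    by rewrite mcoeffZ mcoeffX eqxx mulr1.
  by move=> k kl; rewrite mcoeffZ mcoeffX eq_sym (negbTE kl) mulr0 mul0r.
rewrite !H ?E// => i; rewrite mem_undup mem_cat; apply/orP.
  by right; apply: map_f; rewrite mem_enum.
by left; apply: map_f; rewrite mem_enum.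
Qed.

(** * The Levi difference operator *)

Lemma binD2 p q : ('C(p + q, 2) = 'C(p, 2) + 'C(q, 2) + p * q)%N.
Proof.
elim: p => [|m IH]; first by rewrite add0n mul0n addn0 bin0n.
by rewrite addSn !binS !bin1 IH mulSn; lia.
Qed.

Section LeviSum.
Variables (p q : nat).

Definition nc_root (R : pzRingType) (e : 'I_p * 'I_q) : 'rV[R]_(p + q) :=
  delta_mx 0 (lshift q e.1) + delta_mx 0 (rshift p e.2).

(** The sum over [A] in the orbit sum, without the translation by [- rho_n] and without the
    normalisation of [P_K]. *)
Definition levi_diff (R : comNzRingType) (x : 'rV[R]_(p + q)) : R :=
  cube_diff (@nc_root R) (fun y => \det (Vandermonde (p + q) y)) setT x.

(** The Vandermonde polynomial has degree ['C(p + q, 2)], and each of the [p * q] roots lowers it by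
    one. *)
Lemma poly_fun_levi_diff (R : comNzRingType) :
  poly_fun ('C(p, 2) + 'C(q, 2)) (@levi_diff R).
Proof.
apply: poly_fun_cube_diff; rewrite cardsT card_prod !card_ord.
rewrite -binD2 -bin2_sum big_mkord.
apply: (@eq_poly_fun _ _ _ (fun x : 'rV[R]_(p + q) => \sum_(s : 'S_(p + q))
   (-1) ^+ s * \prod_i x 0 (s i) ^+ i)).
  by apply: poly_fun_sum => s; apply: poly_funZ; apply: poly_fun_monomial.
move=> x; apply: eq_bigr => s _; congr (_ * _); apply: eq_bigr => i _.
by rewrite mxE.
Qed.

(** Block permutations permute the roots [nc_root], so the operator commutes with them and the sign
    comes from the Vandermonde determinant. *)
Lemma levi_diff_block_perm (R : comNzRingType) s t (x : 'rV[R]_(p + q)) :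
  levi_diff (block_perm s t x) = (-1) ^+ s * (-1) ^+ t * levi_diff x.
Proof.
pose u (e : 'I_p * 'I_q) := (s e.1, t e.2).
have iu : injective u by move=> [i j] [k l] [/perm_inj -> /perm_inj ->].
rewrite /levi_diff /cube_diff [in RHS](reindex_inj (imset_inj iu)) big_distrr/=.
apply: eq_big => B; first by rewrite !powersetE !subsetT.
move=> _; rewrite card_imset// mulrCA; congr (_ * _).
rewrite -det_Vandermonde_block_perm; congr (\det (Vandermonde _ _)).
rewrite big_imset/=; last by move=> ? ? _ _ /iu.
apply/rowP => i; have [j ->|j ->] := split_ordP i.
  rewrite [RHS]block_perm_l [LHS]mxE [RHS]mxE block_perm_l !summxE; congr (_ + _).
  by apply: eq_bigr => e _; rewrite !mxE !eq_lshift !eq_lrshift (inj_eq perm_inj).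
rewrite [RHS]block_perm_r [LHS]mxE [RHS]mxE block_perm_r !summxE; congr (_ + _).
by apply: eq_bigr => e _; rewrite !mxE !eq_rlshift !eq_rshift (inj_eq perm_inj).
Qed.

Lemma levi_diff_prop (K : numFieldType) :
  exists e, forall x : 'rV[K]_(p + q), levi_diff x = e * block_vdm x.
Proof.
exact: block_antisym_prop (@poly_fun_levi_diff K) (@levi_diff_block_perm K).
Qed.

Definition block_delta (R : pzRingType) : 'rV[R]_(p + q) :=
  row_mx (\row_i i%:R) (\row_j j%:R).

(** The exponent of the variable [i] in the term of [w] once the powers in the second block are
    reversed. *)
Definition half_rev (w : 'S_(p + q)) (i : 'I_(p + q)) : 'I_(p + q) :=
  if (i < p)%N then w i else rev_ord (w i).

(* Reversing the last q exponents turns the product over pairs in different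
   blocks into the missing factors of a full Vandermonde determinant. *)
Lemma block_vdm_prod (R : idomainType) (X : 'rV[R]_(p + q)) :
  (forall i, X 0 i != 0) ->
  block_vdm X * \prod_(e : 'I_p * 'I_q)
     (1 - X 0 (lshift q e.1) * X 0 (rshift p e.2)) =
  (-1) ^+ 'C(q, 2) *
  \sum_(w : 'S_(p + q)) (-1) ^+ w * \prod_i X 0 i ^+ half_rev w i.
Proof.
(* With these [a] and [b] the factor [b i * a j - a i * b j] is [X_j - X_i] in the first block,
   [1 - X_i X_j] across the blocks, and [X_i - X_j] in the second block, whence the sign. *)
move=> X0; pose a (i : 'I_(p + q)) := if (i < p)%N then X 0 i else 1.
pose b (i : 'I_(p + q)) := if (i < p)%N then 1 else X 0 i.
have b0 i : b i != 0 by rewrite /b; case: ifP => // _; rewrite oner_neq0.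
transitivity ((-1) ^+ 'C(q, 2) *
  \det (\matrix_(i, k) (a i ^+ k * b i ^+ ((p + q).-1 - k)))); last first.
  congr (_ * _); apply: eq_bigr => w _; congr (_ * _); apply: eq_bigr => i _.
  rewrite mxE /a /b /half_rev; case: ifP => _.
    by rewrite expr1n mulr1.
  by rewrite expr1n mul1r /=; congr (_ ^+ _); lia.
rewrite det_hom_Vandermonde// /block_vdm !det_Vandermonde big_split_ord/=.
have al (i : 'I_p) : a (lshift q i) = X 0 (lshift q i) by rewrite /a /= ltn_ord.
have bl (i : 'I_p) : b (lshift q i) = 1 by rewrite /b /= ltn_ord.
have ar (i : 'I_q) : a (rshift p i) = 1 by rewrite /a /= ltnNge leq_addr.
have br (i : 'I_q) : b (rshift p i) = X 0 (rshift p i).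
  by rewrite /b /= ltnNge leq_addr.
rewrite -(pair_bigA _ (fun i j => 1 - X 0 (lshift q i) * X 0 (rshift p j)))/=.
set A := \prod_(i < p) _; set B := \prod_(i < q) _; set M := \prod_(i < p) _.
set A' := \prod_(i < p) _; set B' := \prod_(i < q) _.
have -> : A' = A * M.
  rewrite -big_split/=; apply: eq_bigr => i _; rewrite big_split_ord/=.
  congr (_ * _); first by apply: eq_bigr => j _; rewrite !mxE !al !bl !mul1r mulr1.
  apply: eq_big => j; first by rewrite ltn_addr.
  by rewrite al bl ar br mulr1.
have -> : B' = (-1) ^+ 'C(q, 2) * B.
  rewrite -sum_ltn_pairs -prodrXr -big_split/=; apply: eq_bigr => i _.
  rewrite -prodrXr big_split_ord/= big1 ?mul1r; last first.
    by move=> j; have := ltn_ord j; rewrite /=; lia.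
  rewrite -big_split/=; apply: eq_big => j; first by rewrite ltn_add2l.
  by move=> _; rewrite !ar !br !mxE; ring.
by rewrite [A * M * _]mulrCA [RHS]mulrA -expr2 sqrr_sign mul1r mulrAC.
Qed.

Definition block_exponent (s : 'S_p) (t : 'S_q) (i : 'I_(p + q)) : nat :=
  match split i with inl j => s j | inr j => t j end.

Lemma block_exponent_l s t i : block_exponent s t (lshift q i) = s i.
Proof. by rewrite /block_exponent (unsplitK (inl i)). Qed.

Lemma block_exponent_r s t j : block_exponent s t (rshift p j) = t j.
Proof. by rewrite /block_exponent (unsplitK (inr j)). Qed.

Lemma block_vdm_sum (R : comNzRingType) (X : 'rV[R]_(p + q)) :
  block_vdm X = \sum_(st : 'S_p * 'S_q)
    (-1) ^+ st.1 * (-1) ^+ st.2 * \prod_i X 0 i ^+ block_exponent st.1 st.2 i.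
Proof.
rewrite /block_vdm -det_tr -[\det (Vandermonde q _)]det_tr /determinant.
rewrite big_distrlr pair_bigA/=; apply: eq_bigr => -[s t] _ /=.
rewrite big_split_ord/= mulrACA; congr (_ * _ * (_ * _)); apply: eq_bigr => i _.
  by rewrite !mxE block_exponent_l.
by rewrite !mxE block_exponent_r.
Qed.

Lemma prod_1subM_sum (R : comNzRingType) (X : 'rV[R]_(p + q)) :
  \prod_(e : 'I_p * 'I_q) (1 - X 0 (lshift q e.1) * X 0 (rshift p e.2)) =
  \sum_(B : {set 'I_p * 'I_q}) (-1) ^+ #|B| *
     \prod_(e in B) (X 0 (lshift q e.1) * X 0 (rshift p e.2)).
Proof.
under eq_bigr do rewrite addrC.
rewrite bigA_distr; apply: eq_bigr => B _.
by rewrite -big_mkcond/= prodrN.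
Qed.

(** Apply the functional sending [x^m] to the Vandermonde determinant at [m] to both sides of
    [block_vdm_prod]. On the left, multiplying by [X_i X_j] becomes a shift by a root, so each pair
    of block permutations contributes a signed value of [levi_diff] at a permuted [block_delta]. *)
Lemma levi_diff_delta (K : fieldType) :
  (p`! * q`!)%:R * levi_diff (block_delta K) =
  (-1) ^+ 'C(q, 2) * \sum_(w : 'S_(p + q))
    (-1) ^+ w * \det (Vandermonde (p + q) (\row_i (half_rev w i)%:R)) :> K.
Proof.
pose X : 'rV[{mpoly K[p + q]}]_(p + q) := \row_i 'X_i.
have X0 i : X 0 i != 0 by rewrite mxE -msupp_eq0 msuppX.
have mX (m : 'X_{1..p + q}) : \prod_i X 0 i ^+ m i = 'X_[m].
  by rewrite mpolyXE_id; apply: eq_bigr => i _; rewrite mxE.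
pose M (x : 'S_p * 'S_q * {set 'I_p * 'I_q}) : 'X_{1..p + q} :=
  ([multinom block_exponent x.1.1 x.1.2 i | i < p + q] +
   \sum_(e in x.2) (U_(lshift q e.1) + U_(rshift p e.2)))%MM.
pose M' (w : 'S_(p + q)) : 'X_{1..p + q} := [multinom (half_rev w i : nat) | i < p + q].
pose g (m : 'X_{1..p + q}) : K := \det (Vandermonde (p + q) (\row_i (m i)%:R)).
have := @eq_mpoly_functional K _ _ _
  (fun x : 'S_p * 'S_q * {set 'I_p * 'I_q} =>
     (-1) ^+ x.1.1 * (-1) ^+ x.1.2 * (-1) ^+ #|x.2|) M
  (fun w : 'S_(p + q) => (-1) ^+ 'C(q, 2) * (-1) ^+ w) M' g.
have -> : \sum_(x : 'S_p * 'S_q * {set 'I_p * 'I_q})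
    ((-1) ^+ x.1.1 * (-1) ^+ x.1.2 * (-1) ^+ #|x.2|) *: 'X_[M x] =
    block_vdm X * \prod_(e : 'I_p * 'I_q)
     (1 - X 0 (lshift q e.1) * X 0 (rshift p e.2)).
  rewrite block_vdm_sum prod_1subM_sum big_distrlr pair_bigA/=.
  apply: eq_bigr => -[[s t] B] _ /=.
  rewrite -mul_mpolyC !rmorphM /= !rmorph_sign.
  rewrite mulrACA; congr (_ * _); rewrite mpolyXD; congr (_ * _).
    by rewrite -mX; apply: eq_bigr => i _; rewrite mnmE.
  rewrite -mprodXE; apply: eq_bigr => e _.
  by rewrite mpolyXD !mxE.
rewrite block_vdm_prod// big_distrr/=.
have -> : \sum_(w : 'S_(p + q)) ((-1) ^+ 'C(q, 2) * (-1) ^+ w) *: 'X_[M' w] =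
    \sum_(w : 'S_(p + q)) (-1) ^+ 'C(q, 2) *
      ((-1) ^+ w * \prod_i X 0 i ^+ half_rev w i).
  apply: eq_bigr => w _.
  rewrite -mul_mpolyC !rmorphM /= !rmorph_sign -mulrA -mX.
  by congr (_ * (_ * _)); apply: eq_bigr => i _; rewrite mnmE.
move=> /(_ erefl) H.
transitivity (\sum_(w : 'S_(p + q)) (-1) ^+ 'C(q, 2) * (-1) ^+ w * g (M' w));
    last first.
  rewrite big_distrr/=; apply: eq_bigr => w _; rewrite -mulrA.
  congr (_ * (_ * \det (Vandermonde _ _))).
  by apply/rowP => i; rewrite !mxE mnmE.
rewrite -{}H.
(* By block antisymmetry all these terms equal the value at [block_delta]; there are [p! q!] of
   them. *)
transitivity (\sum_(st : 'S_p * 'S_q) (-1) ^+ st.1 * (-1) ^+ st.2 *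
    levi_diff (block_perm st.1 st.2 (block_delta K))).
  under eq_bigr => st _.
    rewrite levi_diff_block_perm mulrA mulrACA -!expr2 !sqrr_sign !mul1r.
    over.
  by rewrite sumr_const card_prod !card_Sn mulr_natl.
transitivity (\sum_(st : 'S_p * 'S_q) \sum_(B : {set 'I_p * 'I_q})
   (-1) ^+ st.1 * (-1) ^+ st.2 * (-1) ^+ #|B| * g (M (st, B))); last first.
  by rewrite pair_bigA/=; apply: eq_bigr => -[[s t] B] _.
apply: eq_bigr => -[s t] _; rewrite big_distrr/=.
apply: eq_big => B; first by rewrite powersetE subsetT.
move=> _; rewrite mulrA; congr (_ * \det (Vandermonde _ _)).
apply/rowP => i; rewrite [RHS]mxE [LHS]mxE summxE mnmDE mnm_sumE mnmE natrD.
rewrite natr_sum; congr (_ + _).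
  have [j ->|j ->] := split_ordP i.
    by rewrite block_perm_l block_exponent_l row_mxEl mxE.
  by rewrite block_perm_r block_exponent_r row_mxEr mxE.
apply: eq_bigr => e _; rewrite mnmDE !mnm1E natrD !mxE.
by rewrite ![i == _]eq_sym.
Qed.

End LeviSum.

(** * Reversal-stable subsets *)

Section ReversalStable.
Variable n : nat.
Local Open Scope nat_scope.
Implicit Types A : {set 'I_n}.

Definition rev_stable A := [forall x, (rev_ord x \in A) == (x \in A)].

Lemma rev_stableP A :
  reflect (forall x, (rev_ord x \in A) = (x \in A)) (rev_stable A).
Proof. exact: 'forall_eqP. Qed.

(** One representative of each two-element orbit of the reversal. *)
Definition low_half : {set 'I_n} := [set x : 'I_n | x < n./2].
Definition rev_fixed : {set 'I_n} := [set x | rev_ord x == x].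

Lemma half_trichotomy (x : 'I_n) :
  [|| x \in low_half, rev_ord x \in low_half | x \in rev_fixed].
Proof. by rewrite !inE -val_eqE /=; have := ltn_ord x; lia. Qed.

Lemma low_half_rev (x : 'I_n) : x \in low_half -> rev_ord x \notin low_half.
Proof. by rewrite !inE /=; have := ltn_ord x; lia. Qed.

Lemma card_low_half : #|low_half| = n./2.
Proof.
rewrite -sum1_card (eq_bigl (fun x : 'I_n => x < n./2)); last by move=> x; rewrite inE.
rewrite -(big_ord_widen n (fun=> 1)) ?sum1_card ?card_ord//; lia.
Qed.

Lemma card_rev_fixed : #|rev_fixed| = odd n.
Proof.
have [on|en] := boolP (odd n); last first.
  apply/eqP; rewrite cards_eq0; apply/eqP/setP => x; rewrite !inE -val_eqE/=.
  by have := ltn_ord x; lia.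
have nn : n./2 < n by lia.
transitivity #|[set Ordinal nn]|; last by rewrite cards1.
apply: eq_card => x; rewrite !inE -!val_eqE/=.
by have := ltn_ord x; lia.
Qed.

Definition rev_closure (B : {set 'I_n}) := B :|: @rev_ord n @: B.

Lemma mem_rev_closure B x :
  (x \in rev_closure B) = (x \in B) || (rev_ord x \in B).
Proof. by rewrite inE -{2}[x]rev_ordK mem_imset//; exact: rev_ord_inj. Qed.

Lemma card_rev_closure (B : {set 'I_n}) :
  B \subset low_half -> #|rev_closure B| = (#|B|).*2.
Proof.
move=> BL; rewrite cardsU card_imset; last exact: rev_ord_inj.
rewrite (_ : _ :&: _ = set0) ?cards0 ?subn0 ?addnn//.
apply/setP => x; rewrite !inE; apply/negP => /andP[/(subsetP BL) xL /imsetP[y]].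
by move=> /(subsetP BL) /low_half_rev /negP + xy; rewrite -xy.
Qed.

Lemma rev_stable_decomp A : rev_stable A ->
  A = rev_closure (A :&: low_half) :|: A :&: rev_fixed.
Proof.
move=> /rev_stableP sA; apply/setP => x.
rewrite in_setU mem_rev_closure !in_setI sA.
by have := half_trichotomy x; case: (x \in A) => /=; rewrite ?orbA.
Qed.

Lemma disjoint_rev_fixed (B C : {set 'I_n}) : B \subset low_half ->
  C \subset rev_fixed -> rev_closure B :&: C = set0.
Proof.
move=> /subsetP BL /subsetP CM; apply/setP => x.
rewrite in_setI mem_rev_closure inE; apply/negP => /andP[+ /CM].
rewrite inE => + /eqP xx; rewrite xx orbb => /BL xL.
by have := low_half_rev xL; rewrite xx xL.
Qed.

Lemma card_rev_stable_decomp A : rev_stable A ->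
  #|A| = (#|A :&: low_half|).*2 + #|A :&: rev_fixed|.
Proof.
move=> sA; rewrite {1}(rev_stable_decomp sA) cardsU card_rev_closure ?subsetIr//.
by rewrite disjoint_rev_fixed ?subsetIr// cards0 subn0.
Qed.

(** A stable set is determined by its trace on [low_half] and by whether it contains the fixed
    point, which exists only for odd [n]. The parity of [k] decides the latter, leaving a free
    choice of [k./2] orbits. *)
Lemma card_rev_stable k :
  #|[set A | rev_stable A && (#|A| == k)]| =
  if ~~ odd n && odd k then 0 else 'C(n./2, k./2).
Proof.
have fixE A : rev_stable A -> #|A| = k ->
    #|A :&: rev_fixed| = odd k /\ #|A :&: low_half| = k./2.
  move=> /card_rev_stable_decomp -> <-.
  have : #|A :&: rev_fixed| <= 1.
    by rewrite (leq_trans (subset_leq_card (subsetIr _ _)))// card_rev_fixed leq_b1.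
  by case: #|A :&: rev_fixed| => [|[|//]] _; rewrite ?addn0 ?addn1 /=; lia.
case: ifPn => [/andP[en ok]|nok].
  apply/eqP; rewrite cards_eq0; apply/eqP/setP => A; rewrite !inE.
  apply/negP => /andP[sA /eqP Ak]; have [+ _] := fixE _ sA Ak.
  have := subset_leq_card (subsetIr A rev_fixed).
  by rewrite card_rev_fixed ok (negbTE en) => /[swap] ->.
rewrite -card_low_half -cards_draws -(@card_in_imset _ _ (fun A => A :&: low_half)).
  apply: eq_card => B; rewrite inE; apply/imsetP/andP => [[A]|[BL /eqP Bk]].
    rewrite inE => /andP[sA /eqP Ak] ->; rewrite subsetIr; split=> //.
    by have [_ ->] := fixE _ sA Ak.
  (* The middle point is added exactly for odd [k]; [nok] then makes [n] odd, so the point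
     exists. *)
  pose C := if odd k then rev_fixed else set0.
  have CM : C \subset rev_fixed by rewrite /C; case: ifP; rewrite ?sub0set.
  have cC : #|C| = odd k.
    rewrite /C; case: ifP nok => _; rewrite ?cards0// card_rev_fixed.
    by rewrite andbT negbK => ->.
  have CL : C :&: low_half = set0.
    apply/setP => x; rewrite !inE; apply/negP => /andP[/(subsetP CM)].
    rewrite inE => /eqP xx xL; have := @low_half_rev x.
    by rewrite xx !inE xL => /(_ isT).
  exists (rev_closure B :|: C).
    rewrite inE; apply/andP; split.
      apply/rev_stableP => x; rewrite ![_ \in _ :|: C]in_setU !mem_rev_closure rev_ordK orbC.
      rewrite [X in _ = X || _]orbC orbC; congr (_ || _); rewrite /C.
      by case: ifP => _; rewrite !inE ?rev_ordK 1?eq_sym.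
    rewrite cardsU card_rev_closure// disjoint_rev_fixed// cards0 subn0 cC Bk.
    by rewrite addnC odd_double_half.
  rewrite setIUl CL setU0; apply/setP => x; rewrite in_setI mem_rev_closure.
  apply/idP/andP => [xB|[/orP[//|/(subsetP BL) xL] xL']].
    by rewrite xB (subsetP BL _ xB).
  by have := low_half_rev xL'; rewrite xL.
move=> A A'; rewrite !inE => /andP[sA /eqP Ak] /andP[sA' /eqP Ak'] E.
rewrite (rev_stable_decomp sA) (rev_stable_decomp sA') E; congr (_ :|: _).
have [cA _] := fixE _ sA Ak; have [cA' _] := fixE _ sA' Ak'.
have [ok|ek] := boolP (odd k); last first.
  by rewrite (negbTE ek) in cA cA'; rewrite (cards0_eq cA) (cards0_eq cA').
have full D : #|D :&: rev_fixed| = odd k -> D :&: rev_fixed = rev_fixed.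
  move=> cD; apply/eqP; rewrite eqEcard subsetIr cD ok card_rev_fixed.
  by case: (odd n).
by rewrite (full A cA) (full A' cA').
Qed.

Definition rev_on A (x : 'I_n) := if x \in A then rev_ord x else x.

Lemma rev_on_inj A : rev_stable A -> injective (rev_on A).
Proof.
move=> /rev_stableP sA; apply: (can_inj (g := rev_on A)) => x; rewrite /rev_on.
by case: (ifP (x \in A)) => xA; rewrite ?sA xA ?rev_ordK.
Qed.

(** The reversal on [A] is a product of [#|A|./2] transpositions. The induction bounds the cardinal
    because a whole pair is removed each time. *)
Lemma odd_rev_on A (sA : rev_stable A) : perm (rev_on_inj sA) = odd (#|A|./2) :> bool.
Proof.
move: {2}#|A| (leqnn #|A|) => m; elim: m A sA => [|m IH] A sA.
  rewrite leqn0 cards_eq0 => /eqP A0; rewrite A0 in sA *; rewrite cards0/=.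
  rewrite (_ : perm _ = 1%g) ?odd_perm1//; apply/permP => x.
  by rewrite permE /rev_on inE perm1.
move=> cA.
have [/existsP[x /andP[xA xx]]|nx] :=
  boolP [exists x, (x \in A) && (rev_ord x != x)].
  have sA' : rev_stable (A :\ x :\ rev_ord x).
    apply/rev_stableP => y; rewrite !inE (rev_stableP _ sA) (inj_eq rev_ord_inj).
    by rewrite -(inj_eq rev_ord_inj (rev_ord y)) rev_ordK; case: eqP; case: eqP.
  have rA : rev_ord x \in A by rewrite (rev_stableP _ sA).
  have cA' : #|A| = #|A :\ x :\ rev_ord x|.+2.
    by rewrite (cardsD1 x A) xA (cardsD1 (rev_ord x) (A :\ x)) !inE xx rA.
  have -> : perm (rev_on_inj sA) = (tperm x (rev_ord x) * perm (rev_on_inj sA'))%g.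
    apply/permP => y; rewrite permM [LHS]permE [RHS]permE /rev_on.
    case: (tpermP x (rev_ord x) y) => [->|->|/eqP yx /eqP yr].
    - by rewrite setD11 xA.
    - by rewrite rA !inE ?eqxx /= ?andbF ?rev_ordK.
    - by rewrite !inE yx yr.
  rewrite odd_permM odd_tperm eq_sym xx IH; last by lia.
  by rewrite cA'.
have Afix x : x \in A -> rev_ord x = x.
  move=> xA; apply/eqP/negPn/negP => xx; case/negP: nx; apply/existsP.
  by exists x; rewrite xA.
rewrite (_ : perm _ = 1%g) ?odd_perm1//; last first.
  by apply/permP => x; rewrite permE /rev_on perm1; case: ifP => // /Afix.
(* No pair is left, so [A] contains at most the middle point and [#|A|./2] is 0. *)
have : #|A| <= 1.
  rewrite (leq_trans _ (leq_b1 (odd n)))// -card_rev_fixed subset_leq_card//.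
  by apply/subsetP => x /Afix; rewrite inE => ->.
by case: #|A| => [|[|]].
Qed.

End ReversalStable.

(** * Permutations carrying one subset onto another *)

Lemma exists_perm_imset (T : finType) (A B : {set T}) :
  #|A| = #|B| -> exists w : {perm T}, w @: A = B.
Proof.
move=> AB; have ABC : #|~: A| = #|~: B|.
  by apply/eqP; rewrite -(eqn_add2l #|A|) cardsC AB cardsC.
(* Both lists enumerate all of [T], the chosen subset first; the permutation matches them position
   by position. *)
pose s := enum A ++ enum (~: A); pose t := enum B ++ enum (~: B).
have st : size s = size t by rewrite !size_cat -!cardE AB ABC.
have mems x : x \in s by rewrite mem_cat !mem_enum inE orbN.
have ut : uniq t.
  rewrite cat_uniq !enum_uniq andbT/=; apply/hasPn => x.
  by rewrite !mem_enum inE.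
pose f x := nth x t (index x s).
have fx x : (index x s < size t)%N by rewrite -st index_mem.
have fi : injective f.
  move=> x y; rewrite /f (set_nth_default y)// => /eqP.
  by rewrite nth_uniq// => /eqP; apply: index_inj.
exists (perm fi); apply/eqP; rewrite eqEcard card_imset; last exact: perm_inj.
rewrite AB leqnn andbT; apply/subsetP => _ /imsetP[x xA ->].
rewrite permE /f /s index_cat mem_enum xA nth_cat -cardE -AB cardE index_mem.
by rewrite mem_enum xA -mem_enum mem_nth// -cardE -AB cardE index_mem mem_enum.
Qed.

(** The permutations are sorted by the image of [A]. Right translation identifies the fibres, so the
    [#|T|!] permutations fall into ['C(#|T|, #|A|)] classes of equal size. *)
Lemma card_perm_imset (T : finType) (A B : {set T}) : #|A| = #|B| ->
  #|[set w : {perm T} | w @: A == B]| = ((#|A|)`! * (#|T| - #|A|)`!)%N.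
Proof.
move=> AB.
have cB (C : {set T}) : #|C| = #|A| ->
    #|[set w : {perm T} | w @: A == C]| = #|[set w : {perm T} | w @: A == A]|.
  move=> CA; have [u uA] := exists_perm_imset (esym CA).
  rewrite -[RHS](card_imset _ (mulIg u)); apply: eq_card => w; rewrite inE.
  have mulE (a b : {perm T}) : (a * b)%g @: A = b @: (a @: A).
    by rewrite -imset_comp; apply: eq_imset => x; rewrite /= permM.
  apply/eqP/imsetP => [wC|[v + ->]]; last by rewrite inE mulE => /eqP ->.
  exists (w * u^-1)%g; last by rewrite mulgKV.
  rewrite inE mulE wC -uA -mulE.
  by apply/eqP; rewrite mulgV -[RHS]imset_id; apply: eq_imset => x; rewrite perm1.
have: (\sum_(C : {set T} | #|C| == #|A|) #|[set w : {perm T} | w @: A == C]| =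
       (#|T|)`!)%N.
  rewrite -cardsT -card_perm -[RHS]sum1_card.
  rewrite [RHS](partition_big (fun w : {perm T} => w @: A) (fun C => #|C| == #|A|))/=.
    apply: eq_bigr => C _; rewrite -sum1_card; apply: eq_bigl => w.
    have -> : w \in perm_on [set: T] by apply/subsetP => x; rewrite inE.
    by rewrite inE.
  by move=> w _; rewrite card_imset//; exact: perm_inj.
have cBA : #|B| = #|A| by [].
rewrite cB// (eq_bigr (fun=> #|[set w : {perm T} | w @: A == A]|)); last first.
  by move=> C /eqP /cB.
rewrite sum_nat_const -cardsE card_draws => E.
have bin0 : (0 < 'C(#|T|, #|A|))%N by rewrite bin_gt0 max_card.
by apply/eqP; rewrite -(eqn_pmul2l bin0) E bin_fact// max_card.
Qed.

(** Matches the sign of a reversal of [m] values with that of the binomial. Two consecutive values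
    are carried through the induction, since [m./2] has period four modulo 2. *)
Lemma odd_bin2 m : odd 'C(m, 2) = odd m./2.
Proof.
suff [] : odd 'C(m, 2) = odd m./2 /\ odd 'C(m.+1, 2) = odd m.+1./2 by [].
elim: m => [//|m [IH1 IH2]]; split=> //.
by rewrite 2!binS !bin1 !oddD IH1 /=; case: (odd m); case: (odd m./2).
Qed.

(** * Evaluation of the Levi difference at the block point *)

Section LeviDiffDelta.
Variables (p q : nat).

Definition last_block : {set 'I_(p + q)} := [set i : 'I_(p + q) | (p <= i)%N].

Lemma card_last_block : #|last_block| = q.
Proof.
rewrite -sum1_card (eq_bigl (fun i : 'I_(p + q) => (p <= i)%N)); last first.
  by move=> i; rewrite inE.
rewrite big_split_ord/= big1 => [|i]; last by rewrite leqNgt ltn_ord.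
rewrite add0n (eq_bigl xpredT) ?sum1_card ?card_ord// => i.
by rewrite leq_addr.
Qed.

Definition delta (R : pzRingType) : 'rV[R]_(p + q) := \row_i i%:R.

Lemma det_Vandermonde_perm (R : comNzRingType) m (w : 'S_m) :
  \det (Vandermonde m (\row_i (w i)%:R)) =
  (-1) ^+ w * \det (Vandermonde m (\row_i i%:R)) :> R.
Proof.
rewrite (_ : Vandermonde m (\row_i (w i)%:R) =
             col_perm w (Vandermonde m (\row_i i%:R))).
  by rewrite col_permE det_mulmx det_perm odd_permV mulrC.
by apply/matrixP => i j; rewrite !mxE.
Qed.

(** If a value [x] is taken on the last block and [rev_ord x] is not, then [rev_ord x] is taken on
    the first block and collides with the reversed [x]. *)
Lemma half_rev_noninj (w : 'S_(p + q)) :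
  ~~ rev_stable (w @: last_block) -> exists i j, i != j /\ half_rev w i = half_rev w j.
Proof.
move=> /forallPn[x]; set J := w @: _.
wlog xJ : x / x \in J => [H|].
  have [xJ|xJ] := boolP (x \in J); first by move: (H x xJ); rewrite xJ.
  rewrite eqbF_neg negbK => rxJ; apply: (H (rev_ord x)) => //.
  by rewrite rev_ordK (negbTE xJ) rxJ.
rewrite xJ eqb_id => rxJ; move: xJ => /imsetP[j]; rewrite inE => pj xj.
pose i := (w^-1)%g (rev_ord x); have wi : w i = rev_ord x by rewrite permKV.
have ip : (i < p)%N.
  rewrite ltnNge; apply: contra rxJ => pi; rewrite -wi; apply: imset_f.
  by rewrite inE.
exists i, j; split; first by apply: contraTneq ip => ->; rewrite -leqNgt.
by rewrite /half_rev ip ltnNge pj/= wi xj.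
Qed.

(** In the stable case [half_rev w] is [w] followed by the reversal on its last [q] values, so the
    sign of [w] cancels and that of the reversal remains. Otherwise two columns coincide. *)
Lemma det_half_rev (R : comNzRingType) (w : 'S_(p + q)) :
  (-1) ^+ w * \det (Vandermonde (p + q) (\row_i (half_rev w i)%:R)) =
  (-1) ^+ 'C(q, 2) * (rev_stable (w @: last_block))%:R *
  \det (Vandermonde (p + q) (delta R)).
Proof.
have [sw|nsw] := boolP (rev_stable _); last first.
  rewrite mulr0 mul0r; have [i [j [ij wij]]] := half_rev_noninj nsw.
  rewrite -det_tr (determinant_alternate ij) ?mulr0// => k.
  by rewrite !mxE wij.
rewrite mulr1.
have hE i : half_rev w i = (w * perm (rev_on_inj sw))%g i.
  rewrite permM permE /rev_on mem_imset; last exact: perm_inj.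
  by rewrite inE /half_rev ltnNge; case: leqP.
have -> : \row_i (half_rev w i)%:R =
    \row_i ((w * perm (rev_on_inj sw))%g i)%:R :> 'rV[R]_(p + q).
  by apply/rowP => i; rewrite !mxE hE.
rewrite det_Vandermonde_perm odd_permM odd_rev_on card_imset; last exact: perm_inj.
rewrite card_last_block signr_addb mulrA mulrA -expr2 sqrr_sign mul1r.
by rewrite -[in RHS]signr_odd odd_bin2.
Qed.

Lemma levi_diff_deltaE (K : numFieldType) :
  levi_diff (block_delta p q K) =
  (if ~~ odd (p + q) && odd q then 0%N else 'C((p + q)./2, q./2))%:R *
  \det (Vandermonde (p + q) (delta K)).
Proof.
have N0 : (p`! * q`!)%:R != 0 :> K.
  by rewrite pnatr_eq0 muln_eq0 negb_or -!lt0n !fact_gt0.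
apply: (mulfI N0); rewrite levi_diff_delta.
under eq_bigr do rewrite det_half_rev.
rewrite -mulr_suml -mulr_sumr !mulrA -expr2 sqrr_sign mul1r; congr (_ * _).
rewrite -natr_sum -natrM; congr (_%:R).
rewrite -card_rev_stable -sum1_card big_distrr/= -big_mkcond/=.
(* Each stable [q]-subset is the image of the last block under [p! q!] permutations, which cancels
   the factor on the left. *)
rewrite (partition_big (fun w : 'S_(p + q) => w @: last_block)
  (fun A => rev_stable A && (#|A| == q)))/=; last first.
  by move=> w ->; rewrite card_imset ?card_last_block ?eqxx//; exact: perm_inj.
rewrite [RHS](eq_bigl (fun A => rev_stable A && (#|A| == q))); last first.
  by move=> A; rewrite inE.
apply: eq_bigr => A /andP[sA /eqP Aq]; rewrite muln1.
have Al : #|last_block| = #|A| by rewrite card_last_block.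
have := card_perm_imset Al; rewrite card_last_block card_ord addnK mulnC => <-.
rewrite -sum1_card; apply: eq_bigl => w; rewrite inE.
by apply/andP/idP => [[]//|/eqP ->].
Qed.

End LeviDiffDelta.

(** * Root sets *)

Section FsetImage.
Local Open Scope fset_scope.
Variables (T : finType) (K : choiceType) (f : T -> K).

Lemma big_fset_image (M : Type) (idx : M) (op : Monoid.com_law idx) key
    (A : finmempred T) (G : K -> M) : {in A &, injective f} ->
  \big[op/idx]_(a <- imfset key f A) G a = \big[op/idx]_(x | in_mem x A) G (f x).
Proof.
move=> fi; rewrite big_imfset//= -[RHS]big_filter; apply: perm_big.
apply: uniq_perm; rewrite ?enum_finmem_uniq ?filter_uniq ?index_enum_uniq// => x.
by rewrite enum_finmemE mem_filter mem_index_enum andbT.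
Qed.

Lemma card_fset_image key (A : finmempred T) : {in A &, injective f} ->
  #|` imfset key f A| = #|A|.
Proof.
move=> fi; rewrite card_in_imfset//= cardE; apply: perm_size.
apply: uniq_perm; rewrite ?enum_finmem_uniq ?enum_uniq// => x.
by rewrite enum_finmemE mem_enum.
Qed.

Lemma fset_image_filter key (A : finmempred T) (Q : pred T) (Q' : pred K) :
  (forall x, in_mem x A -> Q' (f x) = Q x) ->
  [fset a in imfset key f A | Q' a] =
  [fset f x | x in [pred x | in_mem x A && Q x]].
Proof.
move=> QQ'; apply/fsetP => a; apply/imfsetP/imfsetP => -[]/=.
  by move=> _ /andP[/imfsetP[x/= Px ->] Qx] ->; exists x => //;
    apply/andP; split=> //; rewrite -QQ'.
move=> x /andP[Px Qx] ->; exists (f x) => //.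
by apply/andP; split; [apply/imfsetP; exists x | rewrite QQ'].
Qed.

End FsetImage.

Lemma big_fpowerset_image (T : finType) (K : choiceType) (f : T -> K)
    (M : nmodType) (G : {fset K} -> M) : injective f ->
  \sum_(A <- fpowerset [fset f x | x in T]%fset) G A =
  \sum_(B : {set T}) G [fset f x | x in B]%fset.
Proof.
move=> fi; pose F (B : {set T}) := [fset f x | x in B]%fset.
have Fi : injective F.
  move=> B C /fsetP BC; apply/setP => x; have := BC (f x).
  by rewrite !mem_imfset.
have -> : fpowerset [fset f x | x in T]%fset = [fset F B | B in predT]%fset.
  apply/fsetP => A; rewrite fpowersetE; apply/fsubsetP/imfsetP => /=.
    move=> AT; exists [set x | f x \in A] => //; apply/fsetP => a.
    apply/idP/imfsetP => /= [aA|[x]]; last by rewrite inE => ? ->.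
    by have /imfsetP[x _ ax] := AT _ aA; exists x => //; rewrite inE -ax.
  by move=> [B _ ->] a /imfsetP[x _ ->]; apply/imfsetP; exists x.
by rewrite big_fset_image// => ? ? _ _; exact: Fi.
Qed.

Section Roots.
Variables (R : realType) (n : nat).
Local Notation V := 'rV[R[i]]_n.
Implicit Types u v w : V.

Lemma pairingDl u v w : pairing (u + v) w = pairing u w + pairing v w.
Proof. by rewrite -big_split; apply: eq_bigr => i _; rewrite mxE mulrDl. Qed.

Lemma pairingNl u w : pairing (- u) w = - pairing u w.
Proof. by rewrite -sumrN; apply: eq_bigr => i _; rewrite mxE mulNr. Qed.

Lemma pairingC u v : pairing u v = pairing v u.
Proof. by apply: eq_bigr => i _; rewrite mulrC. Qed.

Lemma pairing_eps (i : 'I_n) w : pairing (eps R i) w = w 0 i.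
Proof.
rewrite /pairing (bigD1 i)//= big1 => [|j ji]; rewrite mxE eqxx/= ?eqxx.
  by rewrite mul1r addr0.
by rewrite (negbTE ji) mul0r.
Qed.

Lemma eps_eq (i j : 'I_n) : eps R i 0 j = (i == j)%:R.
Proof. by rewrite mxE eqxx eq_sym. Qed.

(** Reads the vector equation as an equality of multiplicities in [nat], a form that [lia] can
    use. *)
Lemma eps_addD_eq (i j k l : 'I_n) : eps R i + eps R j = eps R k + eps R l ->
  forall m, ((i == m) + (j == m) = (k == m) + (l == m))%N.
Proof.
move=> E m; have := congr1 (fun v : V => v 0 m) E.
rewrite [LHS]mxE [RHS]mxE !eps_eq -!natrD => /eqP.
by rewrite eqr_nat => /eqP.
Qed.

Lemma eps_sub_inj :
  {in [pred x : 'I_n * 'I_n | (x.1 < x.2)%N] &,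
    injective (fun x => eps R x.1 - eps R x.2)}.
Proof.
move=> [i j] [k l]; rewrite !inE/= => ij kl /eqP.
rewrite subr_eq addrAC eq_sym subr_eq eq_sym => /eqP E.
have H := eps_addD_eq E; have := H i; have := H j.
rewrite -!val_eqE /= !eqxx => H1 H2.
by congr (_, _); apply: val_inj => /=; lia.
Qed.

Lemma eps_add_inj :
  {in [pred x : 'I_n * 'I_n | (x.1 <= x.2)%N] &,
    injective (fun x => eps R x.1 + eps R x.2)}.
Proof.
move=> [i j] [k l]; rewrite !inE/= => ij kl E.
have H := eps_addD_eq E; have := H i; have := H j; have := H k; have := H l.
rewrite -!val_eqE /= !eqxx => H1 H2 H3 H4.
by congr (_, _); apply: val_inj => /=; lia.
Qed.

End Roots.

(** * Weyl dimension polynomials *)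

(** The numerators run against the order of the Vandermonde factors and the denominators along it;
    hence one sign per pair. *)
Lemma prod_ltn_quot (K : numFieldType) m (x : 'I_m -> K) :
  \prod_(i < m) \prod_(j < m | (i < j)%N) ((x i - x j) / (j%:R - i%:R)) =
  (-1) ^+ 'C(m, 2) * (\det (Vandermonde m (\row_i x i)) /
                      \det (Vandermonde m (\row_i i%:R))).
Proof.
rewrite !det_Vandermonde -prodf_div -sum_ltn_pairs -prodrXr -big_split/=.
apply: eq_bigr => i _; rewrite -prodf_div -prodrXr -big_split/=.
apply: eq_bigr => j _; rewrite !mxE expr1 mulrA.
by congr (_ / _); ring.
Qed.

Lemma det_Vandermonde_delta_neq0 (K : numFieldType) m :
  \det (Vandermonde m (\row_i i%:R)) != 0 :> K.
Proof.
rewrite det_Vandermonde; apply/prodf_neq0 => i _; apply/prodf_neq0 => j ij.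
by rewrite !mxE subr_eq0 eqr_nat neq_ltn ij orbT.
Qed.

(** Twice a coordinate of the half sum of compact roots: differences of these coordinates are
    [j - i]. *)
Lemma sum_ltn_gtn (K : comNzRingType) m (i : 'I_m) :
  \sum_(j < m) ((i < j)%:R - (j < i)%:R) = m%:R - 1 - i%:R *+ 2 :> K.
Proof.
have H : \sum_(j < m) (j < i)%:R = i%:R :> K.
  rewrite -natr_sum; congr (_%:R); rewrite -big_mkcond/=.
  by rewrite -(big_ord_widen m (fun=> 1%N)) ?sum1_card ?card_ord// ltnW.
transitivity (\sum_(j < m) (1 - (j == i)%:R - (j < i)%:R *+ 2 : K)).
  apply: eq_bigr => j _; rewrite -val_eqE/=.
  by case: ltngtP => _; rewrite /= ?subr0 ?sub0r ?mulr0n ?mulr1n ?subrr; ring.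
rewrite !sumrB sumrMnl H sumr_const card_ord (bigD1 i)//= eqxx big1 ?addr0//.
by move=> j /negbTE ->.
Qed.

Lemma sum_block_pairs (K : comNzRingType) n (b : 'I_n -> bool) (m : 'I_n) :
  \sum_(i < n) \sum_(j < n | (i < j)%N && (b i == b j))
    ((i == m)%:R - (j == m)%:R) =
  \sum_(j < n | b j == b m) ((m < j)%:R - (j < m)%:R) :> K.
Proof.
rewrite [RHS]sumrB (eq_bigr _ (fun i _ => sumrB _ _ _ _)) sumrB; congr (_ - _).
  rewrite (bigD1 m)//= [X in _ + X]big1 ?addr0 => [|i /negbTE im]; last first.
    by apply: big1 => j _; rewrite im.
  rewrite big_mkcondl [RHS]big_mkcond/= big_mkcond/=; apply: eq_bigr => j _.
  by rewrite eqxx [b j == _]eq_sym; case: ltnP; case: ifP.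
rewrite (exchange_big_dep xpredT)//= (bigD1 m)//=.
rewrite [X in _ + X]big1 ?addr0 => [|j /negbTE jm]; last first.
  by apply: big1 => i _; rewrite jm.
rewrite big_mkcond [RHS]big_mkcond/=; apply: eq_bigr => i _.
by rewrite eqxx; case: ltnP; case: eqP.
Qed.

Section BlockWeyl.
Variables (R : realType) (n : nat) (b : 'I_n -> bool).

(** Covers both Weyl polynomials: a constant [b] gives the compact roots of the whole algebra,
    [i < p] those of the Levi subalgebra. *)
Definition block_roots : {fset 'rV[R[i]]_n} :=
  [fset eps R x.1 - eps R x.2 | x in
     [pred x : 'I_n * 'I_n | (x.1 < x.2)%N && (b x.1 == b x.2)]]%fset.

Lemma block_roots_inj : {in [pred x : 'I_n * 'I_n | (x.1 < x.2)%N && (b x.1 == b x.2)] &,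
  injective (fun x => eps R x.1 - eps R x.2)}.
Proof.
by move=> x y; rewrite !inE => /andP[xx _] /andP[yy _]; apply: eps_sub_inj; rewrite inE.
Qed.

Lemma half_sum_block_roots m : half_sum block_roots 0 m =
  2^-1 * \sum_(j < n | b j == b m) ((m < j)%:R - (j < m)%:R).
Proof.
rewrite mxE; congr (_ * _); rewrite big_fset_image/=; last exact: block_roots_inj.
rewrite summxE.
transitivity (\sum_(i < n) \sum_(j < n | (i < j)%N && (b i == b j))
                 ((i == m)%:R - (j == m)%:R) : R[i]).
  by rewrite pair_big_dep/=; apply: eq_bigr => -[i j] _ /=; rewrite !mxE !eqxx ![m == _]eq_sym.
exact: sum_block_pairs.
Qed.

Lemma weyl_dim_block_roots lam : weyl_dim_poly block_roots lam =
  \prod_(i < n) \prod_(j < n | (i < j)%N && (b i == b j))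
    ((lam 0 i - lam 0 j) / (half_sum block_roots 0 i - half_sum block_roots 0 j)).
Proof.
rewrite /weyl_dim_poly big_fset_image/=; last exact: block_roots_inj.
rewrite pair_big_dep/=; apply: eq_bigr => -[i j] _ /=.
by rewrite !(pairingC _ (_ - _)) !pairingDl !pairingNl !pairing_eps.
Qed.

End BlockWeyl.

Lemma P_K_E (R : realType) n (lam : 'rV[R[i]]_n) :
  P_K lam = (-1) ^+ 'C(n, 2) * (\det (Vandermonde n lam) /
                                \det (Vandermonde n (\row_i i%:R))).
Proof.
have -> : P_K lam = weyl_dim_poly (block_roots R (fun _ : 'I_n => true)) lam.
  congr (weyl_dim_poly _ _); apply: eq_imfset => // x.
  by rewrite -!topredE /= eqxx andbT.
rewrite weyl_dim_block_roots.
have L : \row_i lam 0 i = lam by apply/rowP => i; rewrite mxE.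
rewrite -[X in \det (Vandermonde n X) / _]L -prod_ltn_quot.
apply: eq_bigr => i _; apply: eq_big => j.
  by rewrite eqxx andbT.
move=> _; rewrite !half_sum_block_roots.
rewrite -mulrBr.
have E (m : 'I_n) : \sum_(j0 < n | true == true) ((m < j0)%N%:R - (j0 < m)%N%:R) =
    n%:R - 1 - m%:R *+ 2 :> R[i].
  by rewrite -sum_ltn_gtn; apply: eq_bigl.
by rewrite !E; congr (_ / _); field.
Qed.

Section LeviRoots.
Variables (R : realType) (p q : nat).
Local Notation h := (h_orbit R (p + q) p).

Lemma neq_1N1 : 1 != -1 :> R[i].
Proof. by rewrite -subr_eq0 opprK -(natrD _ 1 1) pnatr_eq0. Qed.

Lemma levi_pos_compact_rootsE :
  levi_pos_compact_roots h = block_roots R (fun i : 'I_(p + q) => (i < p)%N).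
Proof.
apply: etrans (@fset_image_filter _ _ _ _ _
  (fun x : 'I_(p + q) * 'I_(p + q) => (x.1 < p)%N == (x.2 < p)%N) _ _) _;
  last exact: eq_imfset.
move=> [i j] _ /=; rewrite pairingDl pairingNl !pairing_eps !mxE.
by do 2! case: ifP => _; rewrite /= subr_eq0 ?eqxx// ?(negbTE neq_1N1)// eq_sym (negbTE neq_1N1).
Qed.

(** Only pairs inside a block contribute, and within each block the half sum is the negated position
    up to a constant. *)
Lemma P_LK_E (lam : 'rV[R[i]]_(p + q)) :
  P_LK h lam = (-1) ^+ ('C(p, 2) + 'C(q, 2)) *
    (block_vdm lam / block_vdm (block_delta p q R[i])).
Proof.
rewrite /P_LK levi_pos_compact_rootsE weyl_dim_block_roots /block_vdm.
rewrite /block_delta row_mxKl row_mxKr exprD invfM.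
have -> : lsubmx lam = \row_i lam 0 (lshift q i) by apply/rowP => i; rewrite !mxE.
have -> : rsubmx lam = \row_i lam 0 (rshift p i) by apply/rowP => i; rewrite !mxE.
rewrite [X in _ = _ * X]mulrACA [RHS]mulrACA -!prod_ltn_quot big_split_ord/=.
congr (_ * _); apply: eq_bigr => i _; rewrite big_split_ord/=.
  rewrite [X in _ * X]big1 ?mulr1 => [|j]; last first.
    by rewrite ltn_ord [(_ + _ < _)%N]ltnNge leq_addr andbF.
  apply: eq_big => j; first by rewrite !ltn_ord eqxx andbT.
  move=> _; rewrite !half_sum_block_roots -mulrBr.
  have E (m : 'I_p) : \sum_(j0 < p + q | (j0 < p)%N == (lshift q m < p)%N)
      ((lshift q m < j0)%N%:R - (j0 < lshift q m)%N%:R) = p%:R - 1 - m%:R *+ 2 :> R[i].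
    rewrite big_split_ord/= [X in _ + X]big1 ?addr0 => [|k]; last first.
      by rewrite ltn_ord ltnNge leq_addr.
    by rewrite -sum_ltn_gtn; apply: eq_bigl => k; rewrite !ltn_ord.
  by rewrite !E; congr (_ / _); field.
rewrite big1 ?mul1r => [|j]; last by move: (ltn_ord j) => /=; lia.
apply: eq_big => j; first by rewrite ltn_add2l ![(_ + _ < _)%N]ltnNge !leq_addr andbT.
move=> _; rewrite !half_sum_block_roots -mulrBr.
have E (m : 'I_q) : \sum_(j0 < p + q | (j0 < p)%N == (rshift p m < p)%N)
    ((rshift p m < j0)%N%:R - (j0 < rshift p m)%N%:R) = q%:R - 1 - m%:R *+ 2 :> R[i].
  rewrite big_split_ord/= big1 ?add0r => [|k]; last first.
    by rewrite ltn_ord [(_ + _ < _)%N]ltnNge leq_addr.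
  rewrite -sum_ltn_gtn; apply: eq_big => k.
    by rewrite ![(_ + _ < _)%N]ltnNge !leq_addr.
  by rewrite !ltn_add2l.
by rewrite !E; congr (_ / _); field.
Qed.

End LeviRoots.

(** * Noncompact roots and the number of positive roots for [h] *)

Section LeviRootData.
Variables (R : realType) (p q : nat).
Local Notation h := (h_orbit R (p + q) p).

(** Noncompact roots take only the values 2, 0 and -2 on [h], so the sum over [C] reduces to the
    empty set. *)
Lemma p1_roots0 : p1_roots h = fset0.
Proof.
have E a : a \in pos_noncompact_roots R (p + q) ->
    [\/ pairing a h = 2, pairing a h = 0 | pairing a h = - 2].
  move=> /imfsetP[[i j] /= _ ->]; rewrite pairingDl !pairing_eps !mxE.
  do 2! case: ifP => _; rewrite ?subrr ?addNr -?opprD.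
  - exact: Or31.
  - exact: Or32.
  - exact: Or32.
  - exact: Or33.
have n21 : 2 != 1 :> R[i] by rewrite -subr_eq0 addrK oner_neq0.
have n01 : 0 != 1 :> R[i] by rewrite eq_sym oner_neq0.
have nN21 : - 2 != 1 :> R[i].
  by rewrite -subr_eq0 -opprD oppr_eq0 -(natrD _ 2 1) pnatr_eq0.
apply/fsetP => a; rewrite in_fset0; apply/negP => /imfsetP[b /= /andP[bS bh] _].
move: bS; rewrite /noncompact_roots => /fsetUP[/E|/imfsetP[d /= /E dh bd]].
  by case=> E'; rewrite E' ?(negbTE n21) ?(negbTE n01) ?(negbTE nN21) in bh.
rewrite bd pairingNl in bh.
by case: dh => E'; rewrite E' ?opprK ?oppr0 ?(negbTE n21) ?(negbTE n01) ?(negbTE nN21) in bh.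
Qed.

Lemma nc_root_inj : injective (@nc_root p q R[i]).
Proof.
move=> [i j] [k l] E.
have := @eps_add_inj R (p + q) (lshift q i, rshift p j) (lshift q k, rshift p l).
rewrite !inE /= => H; have /eqP : (lshift q i, rshift p j) = (lshift q k, rshift p l).
  by apply: H E; rewrite ltnW// ltn_addr.
by rewrite xpair_eqE eq_lshift eq_rshift => /andP[/eqP -> /eqP ->].
Qed.

Lemma levi_pos_noncompact_rootsE :
  levi_pos_noncompact_roots h =
  [fset nc_root R[i] e | e in {: 'I_p * 'I_q}]%fset.
Proof.
apply: etrans (@fset_image_filter _ _ _ _ _
  (fun x : 'I_(p + q) * 'I_(p + q) => (x.1 < p)%N != (x.2 < p)%N) _ _) _.
  move=> [i j] _ /=; rewrite pairingDl !pairing_eps !mxE.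
  do 2! case: ifP => _; rewrite /= ?subrr ?addNr ?eqxx//.
    by rewrite -(natrD _ 1 1) pnatr_eq0.
  by rewrite -opprD oppr_eq0 -(natrD _ 1 1) pnatr_eq0.
apply/fsetP => a; apply/imfsetP/imfsetP => -[] /= [i j].
  move=> /andP[/= ij bb] ->.
  case: (split_ordP i) ij bb => k ->; case: (split_ordP j) => l -> /=.
  - by [].
  - by move=> _ _; exists (k, l).
  - move=> ij _; have : (p + k <= l)%N := ij; have := ltn_ord l; lia.
  - by [].
move=> _ ->; exists (lshift q i, rshift p j) => //; apply/andP; split => /=.
  by have : (i <= p + j)%N by rewrite ltnW// ltn_addr.
by rewrite ltn_ord ltnNge leq_addr.
Qed.

(** The roots positive on [h] are the [p * q] differences across the blocks and the ['C(p.+1, 2)]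
    sums inside the first block; the cross terms cancel modulo 2. *)
Lemma odd_num_pos_roots : odd (num_pos_roots h + p * q) = odd (p.+1)./2.
Proof.
have I1 : {in [pred x : 'I_(p + q) * 'I_(p + q) | (x.1 < x.2)%N &&
    ((x.1 < p)%N && (p <= x.2)%N)] &, injective (fun x => eps R x.1 - eps R x.2)}.
  move=> x y; rewrite !inE => /andP[xx _] /andP[yy _].
  by apply: eps_sub_inj; rewrite inE.
have I2 : {in [pred x : 'I_(p + q) * 'I_(p + q) | (x.1 <= x.2)%N &&
    (x.2 < p)%N] &, injective (fun x => eps R x.1 + eps R x.2)}.
  move=> x y; rewrite !inE => /andP[xx _] /andP[yy _].
  by apply: eps_add_inj; rewrite inE.
pose S1 := [fset (eps R x.1 - eps R x.2)%R | x in [pred x : 'I_(p + q) * 'I_(p + q) |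
   (x.1 < x.2)%N && ((x.1 < p)%N && (p <= x.2)%N)]]%fset.
pose S2 := [fset (eps R x.1 + eps R x.2)%R | x in [pred x : 'I_(p + q) * 'I_(p + q) |
   (x.1 <= x.2)%N && (x.2 < p)%N]]%fset.
have E1 : [fset a in pos_compact_roots R (p + q) | 0 < pairing a h]%fset = S1.
  apply: etrans (@fset_image_filter _ _ _ _ _
    (fun x : 'I_(p + q) * 'I_(p + q) => (x.1 < p)%N && (p <= x.2)%N) _ _) _;
    last exact: eq_imfset.
  move=> [i j] /= ij0; have {ij0} ij : (i < j)%N := ij0.
  rewrite pairingDl pairingNl !pairing_eps !mxE.
  have [jp|jp] := ltnP j p; first by rewrite (ltn_trans ij jp) subrr ltxx.
  by case: ifP => _ /=; rewrite opprK ?addNr ?ltxx// (ltr0n _ 2).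
have E2 : [fset a in pos_noncompact_roots R (p + q) | 0 < pairing a h]%fset = S2.
  apply: etrans (@fset_image_filter _ _ _ _ _
    (fun x : 'I_(p + q) * 'I_(p + q) => (x.2 < p)%N) _ _) _;
    last exact: eq_imfset.
  move=> [i j] /= ij0; have {ij0} ij : (i <= j)%N := ij0.
  rewrite pairingDl !pairing_eps !mxE.
  have [jp|jp] := ltnP j p; first by rewrite (leq_ltn_trans ij jp) (ltr0n _ 2).
  case: ifP => _ /=; first by rewrite subrr ltxx.
  by rewrite -opprD oppr_gt0 lt_gtF// (ltr0n _ 2).
have -> : num_pos_roots h = (#|` S1| + #|` S2|)%N.
  rewrite /num_pos_roots.
  have -> : [fset a in pos_roots R (p + q) | 0 < pairing a h]%fset = (S1 `|` S2)%fset.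
    rewrite -E1 -E2; apply/fsetP => a; rewrite in_fsetU.
    apply/imfsetP/orP => /= [[b /andP[/fsetUP[] bS hb] ->]|].
    - by left; apply/imfsetP; exists b => //; apply/andP.
    - by right; apply/imfsetP; exists b => //; apply/andP.
    by move=> [] /imfsetP[b /= /andP[bS hb] ->]; exists b => //; apply/andP; split=> //;
      apply/fsetUP; [left|right].
  (* Pairing with the all-ones vector gives 0 on [S1] and 2 on [S2]. *)
  have dis : (S1 `&` S2)%fset = fset0.
    apply/fsetP => a; rewrite in_fset0 in_fsetI; apply/negP => /andP[].
    move=> /imfsetP[x _ ->] /imfsetP[y _].
    move=> /(congr1 (fun v => pairing v (const_mx 1))).
    rewrite !pairingDl pairingNl !pairing_eps !mxE subrr => /eqP.
    by rewrite eq_sym -(natrD _ 1 1) pnatr_eq0.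
  by rewrite cardfsU dis cardfs0 subn0.
rewrite !card_fset_image// -!sum1_card.
have -> : (\sum_(x in [pred x : 'I_(p + q) * 'I_(p + q) |
   (x.1 < x.2)%N && ((x.1 < p)%N && (p <= x.2)%N)]) 1 = p * q)%N.
  rewrite -(pair_big_dep xpredT (fun i j : 'I_(p + q) => (i < j) && ((i < p) && (p <= j)))%N
     (fun _ _ => 1%N))/=.
  rewrite big_split_ord/= [X in (_ + X)%N]big1 => [|i _]; last first.
    by apply: big1 => j; rewrite [(p + i < p)%N]ltnNge leq_addr /= andbF.
  rewrite addn0 (eq_bigr (fun=> q)) ?sum_nat_const ?card_ord// => i _.
  rewrite big_split_ord/= big1 ?add0n => [|j]; last first.
    by have := ltn_ord j; rewrite /=; lia.
  rewrite (eq_bigl xpredT) ?sum1_card ?card_ord// => j.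
  by rewrite leq_addr ltn_ord ltn_addr.
have -> : (\sum_(x in [pred x : 'I_(p + q) * 'I_(p + q) |
   (x.1 <= x.2)%N && (x.2 < p)%N]) 1 = 'C(p.+1, 2))%N.
  rewrite -(pair_big_dep xpredT (fun i j : 'I_(p + q) => (i <= j) && (j < p))%N
     (fun _ _ => 1%N))/=.
  rewrite big_split_ord/= [X in (_ + X)%N]big1 => [|i _]; last first.
    by apply: big1 => j /andP[] /=; lia.
  rewrite addn0 binS bin1 -sum_ltn_pairs.
  transitivity (\sum_(i < p) ((\sum_(j < p | (i < j)%N) 1) + 1))%N; last first.
    by rewrite big_split/= sum1_card card_ord.
  apply: eq_bigr => i _; rewrite big_split_ord/= [X in (_ + X)%N]big1 => [|j]; last first.
    by rewrite [(_ + _ < _)%N]ltnNge leq_addr andbF.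
  rewrite addn0 (bigD1 i) ?leqnn ?ltn_ord//= addnC; congr (_ + _)%N.
  by apply: eq_bigl => j; rewrite ltn_ord andbT -val_eqE /=; lia.
by rewrite -odd_bin2 !oddD addbAC addbb.
Qed.

End LeviRootData.

(** * The orbit constant *)

Section OrbitConstant.
Variables (R : realType) (p q : nat).
Local Notation h := (h_orbit R (p + q) p).

Lemma big_nc_root (B : {set 'I_p * 'I_q}) :
  \sum_(a <- [fset nc_root R[i] e | e in B]%fset) a = \sum_(e in B) nc_root R[i] e.
Proof. by rewrite big_fset_image// => ? ? _ _; exact: nc_root_inj. Qed.

Lemma scale2_half_sum n (S : {fset 'rV[R[i]]_n}) : 2 *: half_sum S = \sum_(a <- S) a.
Proof. by rewrite /half_sum scalerA divff ?pnatr_eq0// scale1r. Qed.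

Lemma orbit_sumE lam : orbit_sum h lam =
  (-1) ^+ (num_pos_roots h + 'C(p + q, 2)) *
  (levi_diff (lam - half_sum (levi_pos_noncompact_roots h)) /
   \det (Vandermonde (p + q) (delta p q R[i]))).
Proof.
rewrite /orbit_sum exprD -!mulrA; congr (_ * _); set rho := half_sum _.
rewrite p1_roots0 fpowerset0 levi_pos_noncompact_rootsE.
rewrite (big_fpowerset_image _ (@nc_root_inj R p q)) /levi_diff /cube_diff big_distrl/=.
rewrite big_distrr/=; apply: eq_big => B; first by rewrite powersetE subsetT.
move=> _; rewrite big_seq_fset1 cardfs0 addn0 P_K_E.
rewrite card_fset_image/=; last by move=> ? ? _ _; exact: nc_root_inj.
rewrite !scale2_half_sum big_seq_fset0 subr0 big_nc_root.
by rewrite mulrCA -!mulrA.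
Qed.

(* [half_sum] of the noncompact roots is constant on each of the two blocks. *)
Lemma block_vdm_sub_half_sum (lam : 'rV[R[i]]_(p + q)) :
  block_vdm (lam - half_sum (levi_pos_noncompact_roots h)) = block_vdm lam.
Proof.
rewrite levi_pos_noncompact_rootsE; set rho := half_sum _.
have rhoE i : rho 0 i = 2^-1 * \sum_(e : 'I_p * 'I_q) nc_root R[i] e 0 i.
  rewrite mxE big_fset_image/=; last by move=> ? ? _ _; exact: nc_root_inj.
  by rewrite summxE.
(* Transposing [i] and [j] permutes the roots, so the two coordinates of their sum agree. *)
have rl i j : rho 0 (lshift q i) = rho 0 (lshift q j).
  pose u (e : 'I_p * 'I_q) := (tperm i j e.1, e.2).
  have iu : injective u by move=> [a b] [c d] [/perm_inj -> ->].
  rewrite !rhoE; congr (_ * _); rewrite (reindex_inj iu).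
  apply: eq_bigr => -[a b] _; rewrite !mxE /= !eq_lshift !eq_lrshift.
  by rewrite -(inj_eq (@perm_inj _ (tperm i j)) j) tpermR.
have rr i j : rho 0 (rshift p i) = rho 0 (rshift p j).
  pose u (e : 'I_p * 'I_q) := (e.1, tperm i j e.2).
  have iu : injective u by move=> [a b] [c d] [-> /perm_inj ->].
  rewrite !rhoE; congr (_ * _); rewrite (reindex_inj iu).
  apply: eq_bigr => -[a b] _; rewrite !mxE /= !eq_rshift !eq_rlshift.
  by rewrite -(inj_eq (@perm_inj _ (tperm i j)) j) tpermR.
clearbody rho; rewrite /block_vdm !det_Vandermonde; congr (_ * _);
  apply: eq_bigr => i _; apply: eq_bigr => j _; rewrite !mxE.
  by rewrite (rl j i); ring.
by rewrite (rr j i); ring.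
Qed.

Lemma orbit_sum_prop lam : orbit_sum h lam =
  (if ~~ odd (p + q) && odd p then 0
   else (-1) ^+ ((p + 1) %/ 2) * ('C(p %/ 2 + q %/ 2, p %/ 2))%:R) * P_LK h lam.
Proof.
have [e eE] := levi_diff_prop p q R[i].
have bd0 : block_vdm (block_delta p q R[i]) != 0.
  by rewrite mulf_neq0 ?row_mxKl ?row_mxKr ?det_Vandermonde_delta_neq0.
have d0 : \det (Vandermonde (p + q) (delta p q R[i])) != 0.
  exact: det_Vandermonde_delta_neq0.
rewrite orbit_sumE P_LK_E eE block_vdm_sub_half_sum.
have := levi_diff_deltaE p q R[i]; rewrite eE => eE'.
set c := (X in X%:R) in eE'.
(* The factor [e] is read off at [block_delta], where [block_vdm] does not vanish. *)
have -> : e = c%:R * \det (Vandermonde (p + q) (delta p q R[i])) /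
              block_vdm (block_delta p q R[i]) by rewrite -eE' mulfK.
have -> : (if ~~ odd (p + q) && odd p then 0
   else (-1) ^+ ((p + 1) %/ 2) * ('C(p %/ 2 + q %/ 2, p %/ 2))%:R) =
   (-1) ^+ (p.+1)./2 * c%:R :> R[i].
  rewrite !divn2 addn1 /c; have -> : ~~ odd (p + q) && odd p = ~~ odd (p + q) && odd q.
    by rewrite oddD; case: (odd p); case: (odd q).
  case: ifPn => [_|nc]; first by rewrite mulr0.
  (* Outside the excluded case [p] and [q] are not both odd, so no carry occurs in the halves. *)
  have -> : (p + q)./2 = (p./2 + q./2)%N.
    rewrite -[RHS]addn0; move: nc; rewrite halfD oddD.
    by case: (odd p); case: (odd q); rewrite // addn0.
  by congr (_ * _%:R); rewrite -bin_sub ?leq_addr// addKn.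
(* By [binD2] the binomial of [p + q] contributes an extra [p * q], which is exactly the term in
   [odd_num_pos_roots]. *)
have -> : (-1) ^+ (num_pos_roots h + 'C(p + q, 2)) =
    (-1) ^+ (p.+1)./2 * (-1) ^+ ('C(p, 2) + 'C(q, 2)) :> R[i].
  rewrite -exprD -signr_odd -[RHS]signr_odd; congr (_ ^+ (nat_of_bool _)).
  have := odd_num_pos_roots R p q; rewrite binD2 !oddD => <-.
  by rewrite addbACA addbA -!addbA [odd (p * q) (+) _]addbC !addbA.
have cancel (a b k x y z : R[i]) : x != 0 -> y != 0 ->
    a * b * (k * x / y * z / x) = a * k * (b * (z / y)).
  by move=> x0 y0; field; rewrite x0 y0.
exact: cancel.
Qed.

End OrbitConstant.

Theorem theorem6p11 (R : realType) (n p : nat) (hn : (1 <= n)%N)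
    (hp : (p <= n)%N) (c : R[i]) :
  let r := (p %/ 2)%N in
  let s := ((n - p) %/ 2)%N in
  is_orbit_constant (h_orbit R n p) c <->
  c = (if ~~ odd n && odd p then 0
       else (-1) ^+ ((p + 1) %/ 2) * ('C(r + s, r))%:R).
Proof.
move=> r s; rewrite /r /s; have := subnKC hp; move: (n - p)%N => q nE.
case: _ / nE => {hn hp r s}; split=> [H|-> lam]; last exact: orbit_sum_prop.
(* Uniqueness of [c] needs one point where [P_LK] is nonzero; at [block_delta] it is a sign. *)
have L0 : P_LK (h_orbit R (p + q) p) (block_delta p q R[i]) != 0.
  rewrite P_LK_E mulf_neq0 ?signr_eq0// divff ?oner_neq0//.
  by rewrite mulf_neq0 ?row_mxKl ?row_mxKr ?det_Vandermonde_delta_neq0.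
by apply: (mulIf L0); rewrite -H orbit_sum_prop.
Qed.
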